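(* Let $K\subset\mathbb{R}^n$ be a convex body. The following are equivalent: \begin{enumerate} \item[(i)] $K$ is in Behrend position. \item[(ii)] $K-K$ is in Behrend position. \item[(iii)] $(K-K)/\mathrm{D}(K)$ is in L\''owner position. \item[(iv)] $\operatorname{conv}(\mathrm{D}_K)$ is in L\''owner position. \item[(v)] There exist an $m\in\{n,\dots,\binom{n+1}{2}\}$, scalars $\lambda_1,\dots,\lambda_m\ge 0$, and diametrical directions $u_1,\dots,u_m\in\mathrm{D}_K$ such that \[ \mathrm{I}_n=\sum_{i=1}^m\lambda_i u_iu_i^{\intercal}. \] \end{enumerate}
   Context: A convex body in $\mathbb{R}^n$ is a compact convex set with nonempty interior. $K-K=\{x-y:x,y\in K\}$. $\mathrm{D}(K)=\max\{\|x-y\|:x,y\in K\}$ is the Euclidean diameter, $\mathrm{vol}$ the $n$-dimensional volume, and $\operatorname{idq}(K)=\mathrm{vol}(K)/\mathrm{D}(K)^n$. A convex body $K$ is in Behrend position if $\operatorname{idq}(K)=\max_{A\in \mathrm{GL}_n(\mathbb{R})}\operatorname{idq}(AK)$. The set of diametrical directions of $K$ is $\mathrm{D}_K=\{u\in\mathbb{S}^{n-1}:\exists\,x\in K\text{ with }x+\mathrm{D}(K)[0,u]\subseteq K\}$, i.e. all $(x-y)/\|x-y\|$ with $x,y\in K$, $\|x-y\|=\mathrm{D}(K)$. A compact convex set is in L\''owner position if the Euclidean unit ball $\mathbb{B}_2^n$ contains it and has minimum volume among all (full-dimensional) ellipsoids, with arbitrary center, containing it (in particular, a set that is not full-dimensional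 is not in L\''owner position). $\mathrm{I}_n$ is the $n\times n$ identity matrix. *)

(* Defs.v *)
From HB Require Import structures.
From mathcomp Require Import all_boot all_order all_algebra.
From mathcomp Require Import all_classical all_reals all_analysis.

Set Implicit Arguments.
Unset Strict Implicit.
Unset Printing Implicit Defensive.

Import Order.TTheory GRing.Theory Num.Theory.
Import numFieldNormedType.Exports.

Local Open Scope classical_set_scope.
Local Open Scope ring_scope.

(* Points of R^n are column vectors; the norm that MathComp-Analysis puts on
   'cV[R]_n is the sup norm, which induces the usual topology but is not the
   Euclidean one. *)
Definition enorm (R : realType) (n : nat) (x : 'cV[R]_n) : R :=
  Num.sqrt (\sum_(i < n) x i 0 ^+ 2).

Definition eball (R : realType) (n : nat) : set 'cV[R]_n :=
  [set x | enorm x <= 1].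

(* n-dimensional volume, by iterating the construction of the product measure
   m1 \x m2 = (fun A => \int[m1]_x m2 (xsection A x)), the one-dimensional
   factors being Lebesgue measures. It is the Lebesgue measure on Borel sets,
   and is only meant to be used for those (below: for compact sets). *)
Fixpoint vol (R : realType) (n : nat) : set 'cV[R]_n -> \bar R :=
  match n with
  | 0 => fun A => (\1_A 0)%:E
  | m.+1 => fun A =>
      (\int[@lebesgue_measure R]_t
         vol [set v : 'cV[R]_m | A (col_mx (t : R)%:M v)])%E
  end.

Definition convex_body (R : realType) (n : nat) (K : set 'cV[R]_n) : Prop :=
  [/\ compact K, convex_set K & K° !=set0].

Definition linear_image (R : realType) (n : nat) (A : 'M[R]_n)
  (K : set 'cV[R]_n) : set 'cV[R]_n := [set A *m x | x in K].

Definition difference_body (R : realType) (n : nat) (K : set 'cV[R]_n)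
  : set 'cV[R]_n := [set x - y | x in K & y in K].

Definition dilate (R : realType) (n : nat) (a : R) (K : set 'cV[R]_n)
  : set 'cV[R]_n := [set a *: x | x in K].

Definition conv_hull (R : realType) (n : nat) (S : set 'cV[R]_n)
  : set 'cV[R]_n := smallest (@convex_set R 'cV[R]_n) S.

(* For a nonempty compact set the supremum is attained. *)
Definition diam (R : realType) (n : nat) (K : set 'cV[R]_n) : R :=
  sup [set enorm (x - y) | x in K & y in K].

Definition idq (R : realType) (n : nat) (K : set 'cV[R]_n) : \bar R :=
  (vol K * ((diam K ^+ n)^-1)%:E)%E.

Definition is_maximum (R : realType) (S : set (\bar R)) (m : \bar R) : Prop :=
  S m /\ ubound S m.

Definition behrend_position (R : realType) (n : nat) (K : set 'cV[R]_n)
  : Prop :=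
  is_maximum [set idq (linear_image A K) | A in [set A | A \in unitmx]]
             (idq K).

Definition diametrical_directions (R : realType) (n : nat)
  (K : set 'cV[R]_n) : set 'cV[R]_n :=
  [set u | enorm u = 1 /\
     exists2 x, K x & [set x + diam K *: (t *: u) | t in `[0, 1]] `<=` K].

Definition ellipsoid (R : realType) (n : nat) (E : set 'cV[R]_n) : Prop :=
  exists (c : 'cV[R]_n) (A : 'M[R]_n),
    A \in unitmx /\ E = [set c + A *m x | x in @eball R n].

Definition loewner_position (R : realType) (n : nat) (C : set 'cV[R]_n)
  : Prop :=
  C `<=` @eball R n /\
  forall E : set 'cV[R]_n,
    ellipsoid E -> C `<=` E -> (vol (@eball R n) <= vol E)%E.

(* Main.v *)
Require Import Defs.
From mathcomp Require Import all_boot all_order all_algebra.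
From mathcomp Require Import all_classical all_reals all_analysis.
From mathcomp Require Import measurable_realfun sesquilinear spectral.
From mathcomp Require Import ring lra.
From mathcomp.real_closed Require Import complex.

(* The volume of a linear image is |det A| vol, so each of (i)-(iv) implies the
   following condition (Q): every invertible A that maps K - K into the ball of
   radius D(K) has |det A| <= 1.

   (Q) implies (v) by John's argument. If the identity is not in the cone spanned
   by the matrices uu^T with u diametrical, it can be separated from it: there is
   H with tr H > 0 and u^T H u <= -d < 0 for all these u. For small t > 0 the
   matrix 1 + tH then still maps K - K into the ball of radius D(K), by
   compactness, but det (1 + tH) > 1. The bound on the number of terms is
   Caratheodory's theorem in the space of symmetric matrices.

   Conversely, if 1 = \sum_i l_i u_i u_i^T and |A u_i| <= r for all i, then
   tr (A^T A) = \sum_i l_i |A u_i|^2 <= n r^2, and the arithmetic-geometric mean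
   inequality for the eigenvalues of A^T A gives |det A| <= r^n, from which
   (i)-(iv) follow. *)

Set Implicit Arguments.
Unset Strict Implicit.
Unset Printing Implicit Defensive.

Import Order.TTheory GRing.Theory Num.Theory.
Import numFieldNormedType.Exports.

Local Open Scope classical_set_scope.
Local Open Scope ring_scope.

(** * Continuity and measurability of coordinatewise defined maps *)

(** [vol] is an iterated integral in a fixed order of the coordinates, so the factor |det A| has to
    be derived from it. A block lower triangular matrix respects sections and is handled by
    induction on the dimension together with the affine substitution on the line; the order of
    integration is exchanged only for the swap of the first two coordinates. The sets are closed
    because closed sets are stable under sections and affine preimages, and the volumes of their
    sections are measurable functions. Caratheodory's theorem comes before the separation, not after
    it: with the number of terms fixed and the coefficients bounded, the conic combinations form a
    compact set, so a nearest point to the identity exists, and the bound on m comes with it. *)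

Lemma continuous_mx (R : realType) (T : topologicalType) (m n : nat)
    (f : T -> 'M[R]_(m, n)) :
  (forall i j, continuous (fun t => f t i j)) -> continuous f.
Proof.
move=> fc t A [P fP PA]; apply: filterS (_ : nbhs t (fun s => forall i j, P i j (f s i j))).
  by move=> s Ps; apply: PA.
by apply: filter_forall => i; apply: filter_forall => j; exact: fc (fP i j).
Qed.

Lemma continuous_addr (R : realType) (T : topologicalType) (f g : T -> R) :
  continuous f -> continuous g -> continuous (fun t => f t + g t).
Proof. by move=> cf cg t; apply: cvgD; [exact: cf|exact: cg]. Qed.

Lemma continuous_oppr (R : realType) (T : topologicalType) (f : T -> R) :
  continuous f -> continuous (fun t => - f t).
Proof. by move=> cf t; apply: cvgN; exact: cf. Qed.

Lemma continuous_mulr (R : realType) (T : topologicalType) (f g : T -> R) :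
  continuous f -> continuous g -> continuous (fun t => f t * g t).
Proof. by move=> cf cg t; apply: cvgM; [exact: cf|exact: cg]. Qed.

Lemma continuous_sumr (R : realType) (T : topologicalType) (I : Type) (r : seq I)
    (F : I -> T -> R) :
  (forall i, continuous (F i)) -> continuous (fun t => \sum_(i <- r) F i t).
Proof.
move=> cF; elim: r => [|i r IH].
  by under eq_fun do rewrite big_nil; exact: cst_continuous.
by under eq_fun do rewrite big_cons; exact: continuous_addr.
Qed.

Lemma continuous_mulmx_coord (R : realType) (m n p : nat) (A : 'M[R]_(m, n)) i j :
  continuous (fun x : 'M[R]_(n, p) => (A *m x) i j).
Proof.
under eq_fun do rewrite mxE.
apply: continuous_sumr => k; apply: continuous_mulr; first exact: cst_continuous.
exact: coord_continuous.
Qed.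

Lemma continuous_affine (R : realType) (m n p : nat) (A : 'M[R]_(m, n)) (c : 'M[R]_(m, p)) :
  continuous (fun v : 'M[R]_(n, p) => A *m v + c).
Proof.
apply: continuous_mx => i j; under eq_fun do rewrite mxE.
apply: continuous_addr; first exact: continuous_mulmx_coord.
exact: cst_continuous.
Qed.

Lemma closed_affine (R : realType) (m n : nat) (A : 'M[R]_(m, n)) (c : 'cV[R]_m)
    (K : set 'cV[R]_m) :
  closed K -> closed [set v | K (A *m v + c)].
Proof.
move=> cK.
exact: (continuous_closedP _).1 (continuous_affine (A := A) (c := c)) _ cK.
Qed.

Lemma closed_section (R : realType) (m n : nat) (t : 'cV[R]_m) (K : set 'cV[R]_(m + n)) :
  closed K -> closed [set v | K (col_mx t v)].
Proof.
move=> /(closed_affine (A := col_mx (0 : 'M[R]_(m, n)) 1%:M) (c := col_mx t 0)).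
congr closed; apply/seteqP; split => v /=;
  by rewrite mul_col_mx mul0mx mul1mx add_col_mx add0r addr0.
Qed.

Lemma measurable_closed_comp (R : realType) d (T : measurableType d) (n : nat)
    (g : T -> 'cV[R]_n) (K : set 'cV[R]_n) :
  (forall i, measurable_fun setT (fun t => g t i 0)) -> closed K ->
  measurable [set t | K (g t)].
Proof.
move=> mg cK.
(* K is the intersection over k of the union of the cubes of the grid of mesh
   1/(k+1) that meet K. *)
pose cell (k : nat) (z : 'cV[int]_n) : set 'cV[R]_n :=
  [set v | forall i, v i 0 \in `[(z i 0)%:~R / k.+1%:R, (z i 0 + 1)%:~R / k.+1%:R]].
pose F (k : nat) (z : 'cV[int]_n) : set T :=
  if pselect (exists2 y, K y & cell k z y) then [set t | cell k z (g t)] else set0.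
have -> : [set t | K (g t)] = \bigcap_k \bigcup_z F k z.
  apply/seteqP; split => t /=.
    move=> Kt k _; exists (\col_i Num.floor (g t i 0 * k.+1%:R)) => //.
    have ct : cell k (\col_i Num.floor (g t i 0 * k.+1%:R)) (g t).
      move=> i; rewrite mxE in_itv/= ler_pdivrMr// ler_pdivlMr//.
      by have /andP[-> /ltW ->] := floor_itv (g t i 0 * k.+1%:R).
    by rewrite /F; case: pselect => // -[]; exists (g t).
  move=> h; apply: cK => B /nbhs_ballP[e/= e0 eB].
  have [k ek] : exists k : nat, e^-1 < k.+1%:R.
    exists (Num.trunc e^-1); exact: truncnS_gt.
  have [z _] := h k I; rewrite /F; case: pselect => // -[y Ky cy] /= cg.
  (* [g t] and [y] share a cell of mesh 1/(k+1) < e, so K meets every ball about [g t]. *)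
  exists y; split => //; apply: eB; split => // i j; rewrite ord1.
  have := cy i; have := cg i; rewrite !in_itv/= !ler_pdivrMr// !ler_pdivlMr//.
  rewrite intrD => /andP[a1 a2] /andP[b1 b2].
  rewrite -ball_normE/=; have k0 : 0 < k.+1%:R :> R by [].
  rewrite -(ltr_pM2r k0) -[X in _ * X]gtr0_norm// -normrM.
  apply: (@le_lt_trans _ _ 1).
    by rewrite ler_norml; apply/andP; split; lra.
  by rewrite mulrC -ltr_pdivrMr// div1r.
apply: bigcapT_measurable => k; apply: countable_bigcupT_measurable; first exact: countableP.
move=> z.
rewrite /F; case: pselect => /= [_|_]; last exact: measurable0.
have -> : [set t | cell k z (g t)] = \bigcap_(i in [set: 'I_n]) ((fun t => g t i 0) @^-1`
    `[(z i 0)%:~R / k.+1%:R, (z i 0 + 1)%:~R / k.+1%:R]).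
  by apply/seteqP; split => t /= h i; [move=> _; exact: h|exact: h].
apply: fin_bigcap_measurable => // i _.
rewrite -[X in measurable X]setTI; exact: mg.
Qed.

(** * Volume and linear maps *)

(** The measure |a| times the pushforward under x -> a x + c gives each interval ]x, y] its length,
    so by uniqueness it is Lebesgue measure. *)
Lemma ge0_integral_affine (R : realType) (f : measurableTypeR R -> \bar R) (a c : R) :
  measurable_fun setT f -> (forall x, 0 <= f x)%E -> a != 0 ->
  (`|a|%:E * \int[@lebesgue_measure R]_x f (a * x + c)%R = \int[@lebesgue_measure R]_x f x)%E.
Proof.
move=> mf f0 a0.
pose phi : measurableTypeR R -> measurableTypeR R := fun x => a * x + c.
have mphi : measurable_fun setT phi.
  by apply: measurable_funD => //; apply: measurable_funM.
have a0' : 0 < `|a| by rewrite normr_gt0.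
have [pm pmE] : exists pm : {measure set (measurableTypeR R) -> \bar R},
    pm = pushforward (@lebesgue_measure R) phi :> (set _ -> _).
  by unshelve (eexists; reflexivity).
pose nu := mscale (NngNum (ltW a0')) pm.
have nuE A : measurable A -> lebesgue_measure A = nu A.
  apply: lebesgue_measure_unique => _ [[x y] _ <-].
  rewrite /nu /= /mscale pmE /pushforward/= lebesgue_measure_itv/= lte_fin.
  move: (a0); rewrite neq_lt orbC => /orP[ap|an].
  - have -> : phi @^-1` `]x, y] = `](x - c) / a, (y - c) / a]%classic.
      by apply/seteqP; split => t /=;
        rewrite !in_itv/= /phi ltr_pdivrMr// ler_pdivlMr// ltrBlDr lerBrDr mulrC.
    rewrite lebesgue_measure_itv/= lte_fin ltr_pM2r ?invr_gt0// ltrD2r.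
    case: ifP => xy; last by rewrite mule0.
    by rewrite -!EFinB -EFinM gtr0_norm//; congr (_%:E); field.
  (* For a < 0 the preimage is closed on the left instead of the right, which does not change its
     length. *)
  - have -> : phi @^-1` `]x, y] = `[(y - c) / a, (x - c) / a[%classic.
      by apply/seteqP; split => t /=;
        rewrite !in_itv/= /phi ltr_ndivlMr// ler_ndivrMr// ltrBlDr lerBrDr mulrC andbC.
    rewrite lebesgue_measure_itv/= lte_fin ltr_nM2r ?invr_lt0// ltrD2r.
    case: ifP => xy; last by rewrite mule0.
    by rewrite -!EFinB -EFinM ltr0_norm//; congr (_%:E); field.
rewrite [RHS](eq_measure_integral nu); last by move=> A mA _; exact: nuE.
rewrite ge0_integral_mscale//=.
rewrite pmE ge0_integral_pushforward//= preimage_setT.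
Qed.

Lemma mulmx_col_split (R : pzRingType) (N p m : nat) (M : 'M[R]_(N, p + m))
    (s : 'cV[R]_p) (v : 'cV[R]_m) :
  M *m col_mx s v = lsubmx M *m s + rsubmx M *m v.
Proof. by rewrite -{1}[M]hsubmxK mul_row_col. Qed.

Lemma vol_ge0 (R : realType) (n : nat) (A : set 'cV[R]_n) : (0 <= vol A)%E.
Proof.
elim: n A => [|n IH] A; first by rewrite /= lee_fin.
by apply: integral_ge0.
Qed.

Lemma eq_vol (R : realType) (n : nat) (A B : set 'cV[R]_n) :
  (forall v, A v <-> B v) -> vol A = vol B.
Proof. by move=> AB; congr vol; apply/seteqP; split => v /AB. Qed.

(* The affine parametrization makes the induction on m go through: integrating
   over the first coordinate of v moves the first column of M into f. *)
Lemma measurable_vol (R : realType) (m : nat) d (T : measurableType d) (N : nat)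
    (f : T -> 'cV[R]_N) (M : 'M[R]_(N, m)) (K : set 'cV[R]_N) :
  (forall i, measurable_fun setT (fun t => f t i 0)) -> closed K ->
  measurable_fun setT (fun t => vol [set v | K (f t + M *m v)]).
Proof.
elim: m d T f M => [|m IH] d T f M mf cK.
  rewrite /=; apply/measurable_EFinP; apply: measurable_indic.
  apply: measurable_closed_comp => // i.
  suff -> : (fun t => (f t + M *m 0) i 0) = (fun t => f t i 0) by [].
  by apply/funext => t; rewrite mulmx0 addr0.
pose f' (p : T * measurableTypeR R) : 'cV[R]_N :=
  f p.1 + lsubmx (M : 'M[R]_(N, 1 + m)) *m (p.2 : R)%:M.
have mf' i : measurable_fun setT (fun p => f' p i 0).
  have -> : (fun p => f' p i 0) =
      (fun p => f p.1 i 0 + lsubmx (M : 'M[R]_(N, 1 + m)) i 0 * (p.2 : R)).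
    by apply/funext => p; rewrite !mxE big_ord1 !mxE.
  apply: measurable_funD.
    exact: (measurableT_comp (mf i) measurable_fst).
  by apply: measurable_funM.
have -> : (fun t => vol [set v | K (f t + M *m v)]) =
    fubini_F (@lebesgue_measure R)
      (fun p => vol [set v : 'cV[R]_m | K (f' p + rsubmx (M : 'M[R]_(N, 1 + m)) *m v)]).
  apply/funext => t /=; apply: eq_integral => s _; apply: eq_vol => v /=.
  by rewrite /f' (@mulmx_col_split _ N 1 m) addrA.
apply: measurable_fun_fubini_tonelli_F.
  exact: IH.
by move=> p; exact: vol_ge0.
Qed.

Lemma measurable_vol_section (R : realType) (m : nat) (K : set 'cV[R]_m.+1) :
  closed K ->
  measurable_fun setT (fun t : measurableTypeR R => vol [set v : 'cV[R]_m | K (col_mx t%:M v)]).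
Proof.
move=> cK; pose f (t : measurableTypeR R) : 'cV[R]_(1 + m) := col_mx (t : R)%:M 0.
have -> : (fun t : measurableTypeR R => vol [set v : 'cV[R]_m | K (col_mx t%:M v)]) =
    (fun t => vol [set v | K (f t + col_mx (0 : 'M[R]_(1, m)) 1%:M *m v)]).
  apply/funext => t; apply: eq_vol => v /=.
  by rewrite mul_col_mx mul0mx mul1mx add_col_mx addr0 add0r.
apply: measurable_vol => // i; rewrite /f.
case: (split_ordP (i : 'I_(1 + m))) => j ->.
  have -> : (fun t : measurableTypeR R =>
      (col_mx (t : R)%:M 0 : 'cV[R]_(1 + m)) (lshift m j) 0) = id.
    by apply/funext => t; rewrite col_mxEu !mxE !ord1.
  exact: measurable_id.
under eq_fun do rewrite col_mxEd mxE.
exact: measurable_cst.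
Qed.

(* The change of variables formula is stated for preimages, which preserve
   closed sets and compose well with sections. *)
Definition scales_vol (R : realType) (n : nat) (A : 'M[R]_n) : Prop :=
  forall (K : set 'cV[R]_n) (c : 'cV[R]_n), closed K ->
    (`|\det A|%:E * vol [set v | K (A *m v + c)%R] = vol K)%E.

(** A cancellation rule, because a general matrix will be simplified by right factors that are
    already known to scale volume. *)
Lemma scales_vol_mulr_cancel (R : realType) (n : nat) (A B : 'M[R]_n) :
  scales_vol (A *m B) -> scales_vol B -> scales_vol A.
Proof.
move=> gAB gB K c cK; rewrite -(gB _ 0); last exact: closed_affine.
rewrite muleA -EFinM -normrM -det_mulmx -[RHS](gAB _ c)//.
by congr (_ * _)%E; apply: eq_vol => v /=; rewrite addr0 mulmxA.
Qed.

(** The section at t of the preimage of K is the preimage under B of the section of K at a t + c_1,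
    up to a translation depending on t. The translation is absorbed by the vector quantified in
    [scales_vol]; the outer integral is an affine substitution on the line. *)
Lemma scales_vol_block (R : realType) (m : nat) (a : 'M[R]_1) (w : 'cV[R]_m) (B : 'M[R]_m) :
  a 0 0 != 0 -> \det B != 0 -> scales_vol B ->
  scales_vol (block_mx a 0 w B : 'M[R]_(1 + m)).
Proof.
move=> a0 B0 gB K c cK; rewrite det_lblock (mx11_scalar a) det_scalar1.
have B0' : 0 < `|\det B| by rewrite normr_gt0.
pose f (t : measurableTypeR R) := vol [set v : 'cV[R]_m | K (col_mx (t : R)%:M v)].
have mf : measurable_fun setT f by exact: measurable_vol_section.
have f0 t : (0 <= f t)%E by exact: vol_ge0.
have -> : vol [set v | K (block_mx (a 0 0)%:M 0 w B *m v + c)] =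
    (\int[@lebesgue_measure R]_t ((`|\det B|^-1)%:E * f (a 0 0 * t + usubmx c 0 0)%R))%E.
  apply: eq_integral => t _.
  rewrite /f -(gB _ (w *m (t : R)%:M + dsubmx c)); last exact: closed_section.
  rewrite muleA -EFinM mulVf ?gt_eqF// mul1e; apply: eq_vol => v /=.
  rewrite mul_block_col mul0mx addr0 -{1}[c]vsubmxK add_col_mx.
  have -> : (a 0 0)%:M *m (t : R)%:M + usubmx c = (a 0 0 * (t : R) + usubmx c 0 0)%:M.
    by rewrite -scalar_mxM {1}[usubmx c]mx11_scalar -raddfD.
  by rewrite addrCA addrA addrC.
rewrite ge0_integralZl_EFin//.
  rewrite muleA -EFinM normrM -mulrA divff ?gt_eqF// mulr1.
  by rewrite ge0_integral_affine.
have mg : measurable_fun setT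
    (fun t : measurableTypeR R => (a 0 0 * t + usubmx c 0 0 : measurableTypeR R)).
  by apply: measurable_funD => //; apply: measurable_funM.
exact: measurableT_comp mf mg.
Qed.

Definition swap01_mx (R : realType) (m : nat) : 'M[R]_(1 + (1 + m)) :=
  col_mx (row_mx 0 (row_mx 1%:M 0))
    (col_mx (row_mx 1%:M (row_mx 0 0)) (row_mx 0 (row_mx 0 1%:M))).

Lemma mul_swap01_mx (R : realType) (m p : nat) (s t : 'M[R]_(1, p)) (w : 'M[R]_(m, p)) :
  swap01_mx R m *m col_mx s (col_mx t w) = col_mx t (col_mx s w).
Proof. by rewrite !mul_col_mx !mul_row_col !mul0mx !mul1mx !addr0 !add0r. Qed.

Lemma mul_row_swap01_mx (R : realType) (m p : nat) (s t : 'M[R]_(p, 1)) (w : 'M[R]_(p, m)) :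
  row_mx s (row_mx t w) *m swap01_mx R m = row_mx t (row_mx s w).
Proof.
by rewrite !mul_row_col !mul_mx_row !mulmx0 !mulmx1 !add_row_mx !addr0 !add0r.
Qed.

Lemma det_swap01_mx (R : realType) (m : nat) : `|\det (swap01_mx R m)| = 1.
Proof.
have E : swap01_mx R m *m swap01_mx R m = 1%:M.
  rewrite [X in _ *m X]/swap01_mx mul_swap01_mx !scalar_mx_block /block_mx.
  by rewrite row_mx0 -[X in _ = col_mx _ (row_mx X _)]col_mx0 -block_mxEh block_mxEv.
by apply/eqP; rewrite -(@eqrXn2 _ 2)// expr1n -normrX expr2 -det_mulmx E det1 normr1.
Qed.

(** Tonelli's theorem for the two outermost integrals. The hypothesis on the identity matrix is
    translation invariance, which disposes of c. *)
Lemma scales_vol_swap01 (R : realType) (m : nat) :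
  scales_vol (1%:M : 'M[R]_(1 + (1 + m))) -> scales_vol (swap01_mx R m).
Proof.
move=> g1 K c cK; rewrite det_swap01_mx mul1e.
rewrite -(g1 K c)// det1 normr1 mul1e.
have : closed [set u | K (1%:M *m u + c)] by exact: closed_affine.
set K1 := [set u | _] => cK1.
have -> : [set v | K (swap01_mx R m *m v + c)] = [set v | K1 (swap01_mx R m *m v)].
  by apply/seteqP; split => v /=; rewrite /K1/= mul1mx.
pose RM := measurableTypeR R.
pose F (p : RM * RM) := vol [set w : 'cV[R]_m | K1 (col_mx (p.1 : R)%:M (col_mx (p.2 : R)%:M w))].
have mF : measurable_fun setT F.
  pose f (p : RM * RM) : 'cV[R]_(1 + (1 + m)) := col_mx (p.1 : R)%:M (col_mx (p.2 : R)%:M 0).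
  pose M : 'M[R]_(1 + (1 + m), m) := col_mx 0 (col_mx 0 1%:M).
  have -> : F = (fun p => vol [set v | K1 (f p + M *m v)]).
    apply/funext => p; apply: eq_vol => v /=; rewrite /f /M.
    by rewrite !mul_col_mx !mul0mx mul1mx !add_col_mx !addr0 add0r.
  apply: measurable_vol => // i; rewrite /f.
  case: (split_ordP i) => j ->.
    under eq_fun do rewrite col_mxEu !mxE ord1 mulr1n.
    exact: measurable_fst.
  under eq_fun do rewrite col_mxEd.
  case: (split_ordP j) => k ->.
    under eq_fun do rewrite col_mxEu !mxE ord1 mulr1n.
    exact: measurable_snd.
  under eq_fun do rewrite col_mxEd mxE.
  exact: measurable_cst.
transitivity (\int[@lebesgue_measure R]_s \int[@lebesgue_measure R]_t F (t, s))%E.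
  apply: eq_integral => s _; apply: eq_integral => t _; apply: eq_vol => w /=.
  by rewrite mul_swap01_mx.
rewrite -(fubini_tonelli (m1 := @lebesgue_measure R) (m2 := @lebesgue_measure R) F mF).
  by apply: eq_integral => s _; apply: eq_integral.
by move=> p; exact: vol_ge0.
Qed.

Lemma scales_vol_lower_block (R : realType) (m : nat) (B : 'M[R]_(1 + m)) :
  (forall A : 'M[R]_m, A \in unitmx -> scales_vol A) ->
  B \in unitmx -> ursubmx B = 0 -> scales_vol B.
Proof.
move=> IH uB B0; rewrite -[B]submxK B0.
have : \det B != 0 by rewrite -unitfE -unitmxE.
rewrite -{1}[B]submxK B0 det_lblock mulf_eq0 negb_or.
rewrite {1}(mx11_scalar (ulsubmx B)) det_scalar1 => /andP[a0 d0].
apply: scales_vol_block => //; apply: IH.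
by rewrite unitmxE unitfE.
Qed.

(* If the first row (a b) of A has b != 0, then it can be brought to (0 x 0) by
   a block lower triangular q, and the swap of the first two coordinates then
   makes A q block lower triangular as well. *)
Lemma scales_vol_succ (R : realType) (m : nat) (A : 'M[R]_(1 + m)) :
  (forall A : 'M[R]_m, A \in unitmx -> scales_vol A) ->
  A \in unitmx -> scales_vol A.
Proof.
move=> IH uA.
have [b0|b0] := eqVneq (ursubmx A) 0; first exact: scales_vol_lower_block.
case: m => [|m] in IH A uA b0 *.
  by rewrite (thinmx0 (ursubmx _)) eqxx in b0.
set a := ulsubmx A in b0 *.
set b := ursubmx A in b0 *.
(* The rank factorization of the nonzero row b provides the column operation E that leaves only its
   first entry. *)
have rb : \rank b = 1%N by rewrite rank_rV b0.
pose E := invmx (row_ebase b).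
pose x : 'M[R]_1 := col_ebase b.
have bE : b *m E = row_mx x (0 : 'M[R]_(1, m)).
  rewrite -{1}(mulmx_ebase b) rb mulmxK ?row_ebase_unit//.
  transitivity (x *m (row_mx 1%:M 0 : 'M[R]_(1, 1 + m))).
    by rewrite -(@pid_mx_row _ m 1).
  by rewrite mul_mx_row mulmx1 mulmx0.
(* w solves a + b w = 0, which clears the first entry of the first row of A q. *)
pose w : 'cV[R]_m.+1 := E *m col_mx (invmx x *m - a) (0 : 'cV[R]_m).
pose q : 'M[R]_(1 + m.+1) := block_mx 1%:M 0 w E.
have ux : x \in unitmx by exact: col_ebase_unit.
have uE : E \in unitmx by rewrite unitmx_inv row_ebase_unit.
have uq : q \in unitmx by rewrite unitmxE det_lblock det1 mul1r -unitmxE.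
have bw : b *m w = - a.
  rewrite /w mulmxA bE.
  transitivity (row_mx x (0 : 'M[R]_(1, m)) *m col_mx (invmx x *m - a) (0 : 'cV[R]_m)) => //.
  by rewrite mul_row_col mul0mx addr0 mulmxA mulmxV// mul1mx.
have Aq : usubmx (A *m q) = row_mx 0 (row_mx x 0).
  rewrite -[X in X *m q]submxK /q mulmx_block [LHS]col_mxKu.
  by rewrite -/a -/b mulmx1 mulmx0 add0r bw bE subrr.
have gS : scales_vol (swap01_mx R m).
  apply: scales_vol_swap01; apply: scales_vol_lower_block; [exact: IH|exact: unitmx1|].
  by rewrite scalar_mx_block block_mxKur.
have gq : scales_vol q by apply: scales_vol_lower_block => //; rewrite block_mxKur.
refine (scales_vol_mulr_cancel _ gq); refine (scales_vol_mulr_cancel _ gS).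
apply: (scales_vol_lower_block IH).
  by rewrite !unitmx_mul uA uq/= unitmxE unitfE -normr_eq0 det_swap01_mx oner_neq0.
rewrite /ursubmx -(vsubmxK (A *m q)) Aq mul_col_mx col_mxKu.
by rewrite mul_row_swap01_mx row_mxKr row_mx0.
Qed.

Theorem scales_vol_unitmx (R : realType) (n : nat) (A : 'M[R]_n) :
  A \in unitmx -> scales_vol A.
Proof.
elim: n A => [|m IH] A uA; last exact: (scales_vol_succ (m := m)).
move=> K c cK; rewrite det_mx00 normr1 mul1e; apply: eq_vol => v /=.
by rewrite [v]flatmx0 [_ + c]flatmx0.
Qed.

Lemma vol_affine_image (R : realType) (n : nat) (A : 'M[R]_n) (c : 'cV[R]_n)
    (K : set 'cV[R]_n) :
  A \in unitmx -> closed K ->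
  vol [set c + A *m x | x in K] = (`|\det A|%:E * vol K)%E.
Proof.
move=> uA cK.
rewrite -(scales_vol_unitmx (A := invmx A) _ (- (invmx A *m c)) cK) ?unitmx_inv//.
rewrite muleA -EFinM -normrM -det_mulmx mulmxV// det1 normr1 mul1e.
apply: eq_vol => v /=; split => [[x Kx <-]|Kv].
  by rewrite mulmxDr mulKmx// addrC addKr.
by exists (invmx A *m v - invmx A *m c) => //; rewrite -mulmxBr mulKVmx// addrC subrK.
Qed.

Lemma vol_linear_image (R : realType) (n : nat) (A : 'M[R]_n) (K : set 'cV[R]_n) :
  A \in unitmx -> closed K -> vol (linear_image A K) = (`|\det A|%:E * vol K)%E.
Proof.
move=> uA cK; rewrite -(vol_affine_image 0 uA cK).
by apply: eq_vol => v /=; split => -[x Kx <-]; exists x => //; rewrite add0r.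
Qed.

(** * Monotonicity, finiteness and positivity of the volume *)

Lemma le_vol (R : realType) (n : nat) (A B : set 'cV[R]_n) :
  closed A -> closed B -> A `<=` B -> (vol A <= vol B)%E.
Proof.
elim: n A B => [|n IH] A B cA cB AB /=.
  by rewrite lee_fin !indicE ler_nat; case: (boolP (0 \in A)) => // /set_mem/AB/mem_set ->.
apply: ge0_le_integral => //.
- by move=> t _; exact: vol_ge0.
- exact: measurable_vol_section.
- exact: measurable_vol_section.
- move=> t _; apply: IH; [exact: closed_section|exact: closed_section|].
  by move=> v; exact: AB.
Qed.

Lemma vol0 (R : realType) (n : nat) : vol (@set0 'cV[R]_n) = 0%E.
Proof.
elim: n => [|n IH] /=; first by rewrite indicE in_set0.
by apply: integral0_eq => t _; exact: IH.
Qed.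

(** Boxes are the comparison sets: a bounded set is contained in one, and a set with nonempty
    interior contains one. *)
Lemma vol_box (R : realType) (n : nat) (c : 'cV[R]_n) (r : R) : 0 < r ->
  vol [set v : 'cV[R]_n | forall i, v i 0 \in `[c i 0 - r, c i 0 + r]] = ((2 * r) ^+ n)%:E.
Proof.
move=> r0; elim: n c => [|n IH] c /=.
  by rewrite expr0 indicE mem_set// => -[].
have l0 : (lshift n (0 : 'I_1) : 'I_n.+1) = 0 by exact: val_inj.
have Ed (s : 'cV[R]_1) (v : 'cV[R]_n) i :
  (col_mx s v : 'cV[R]_n.+1) (rshift 1 i) 0 = v i 0 by exact: col_mxEd.
have Eu (s : 'cV[R]_1) (v : 'cV[R]_n) : (col_mx s v : 'cV[R]_n.+1) 0 0 = s 0 0.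
  by rewrite -l0; exact: col_mxEu.
pose I := (`[c 0 0 - r, c 0 0 + r]%classic : set (measurableTypeR R)).
transitivity (\int[@lebesgue_measure R]_t ((\1_I t)%:E * ((2 * r) ^+ n)%:E))%E.
  apply: eq_integral => t _; rewrite indicE.
  have [/set_mem tI|tI] := boolP (t \in I).
    rewrite mul1e -(IH (\col_i c (rshift 1 i) 0)).
    apply: eq_vol => v /=; split => h i.
      by have := h (rshift 1 i); rewrite Ed mxE.
    case: (split_ordP (i : 'I_(1 + n))) => j ->; last by have := h j; rewrite Ed mxE.
    by rewrite (ord1 j) l0 Eu mxE mulr1n.
  rewrite mul0e -[RHS](vol0 R n); apply: eq_vol => v /=; split => // h.
  by move/negP: tI; apply; apply/mem_set; have := h 0; rewrite Eu mxE mulr1n.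
rewrite ge0_integralZr//; last 2 first.
- by apply/measurable_EFinP; apply: measurable_indic; exact: measurable_itv.
- by rewrite lee_fin exprn_ge0// mulr_ge0// ltW.
rewrite integral_indic ?setIT; [|exact: measurableT|exact: measurable_itv].
have := @lebesgue_measure_itv R `[c 0 0 - r, c 0 0 + r].
rewrite /= lte_fin ltrBlDr -addrA ltrDl addr_gt0// => ->.
rewrite -EFinB -EFinM exprS; congr (_ * _)%:E; ring.
Qed.

Lemma coord_le_norm (R : realType) (m n : nat) (x : 'M[R]_(m, n)) i j : `|x i j| <= `|x|.
Proof. by rewrite [leRHS]mx_normrE; apply: (le_bigmax _ (fun ij => `|x ij.1 ij.2|) (i, j)). Qed.

Lemma closed_box (R : realType) (n : nat) (c : 'cV[R]_n) (r : R) :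
  closed [set v : 'cV[R]_n | forall i, v i 0 \in `[c i 0 - r, c i 0 + r]].
Proof.
rewrite (_ : [set _ | _] = \bigcap_(i in [set: 'I_n])
   ((fun v : 'cV[R]_n => v i 0) @^-1` `[c i 0 - r, c i 0 + r]%classic)).
  apply: closed_bigI => i _; apply: (continuous_closedP _).1; first exact: coord_continuous.
  exact: itv_closed.
by apply/seteqP; split => v /= h i; [move=> _; exact: h|exact: h].
Qed.

Lemma vol_bounded_fin (R : realType) (n : nat) (K : set 'cV[R]_n) (M : R) :
  closed K -> (forall v, K v -> forall i, `|v i 0| <= M) -> (vol K < +oo)%E.
Proof.
move=> cK KM; pose r := `|M| + 1; have r0 : 0 < r by rewrite ltr_wpDl.
apply: (@le_lt_trans _ _ ((2 * r) ^+ n)%:E); last exact: ltry.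
rewrite -(vol_box 0 r0); apply: le_vol => //; first exact: closed_box.
move=> v Kv i; rewrite mxE sub0r add0r in_itv/= -ler_norml.
by rewrite (le_trans (KM v Kv i))// (le_trans (ler_norm M))// lerDl.
Qed.

Lemma vol_compact_fin (R : realType) (n : nat) (K : set 'cV[R]_n) :
  compact K -> (vol K < +oo)%E.
Proof.
move=> cK; have [M [Mr KM]] := compact_bounded cK.
apply: (vol_bounded_fin (M := M + 1)); first exact: compact_closed.
move=> v Kv i; apply: (le_trans (coord_le_norm v i 0)); apply: KM => //.
by rewrite ltrDl.
Qed.

Lemma vol_interior_gt0 (R : realType) (n : nat) (K : set 'cV[R]_n) :
  closed K -> K° !=set0 -> (0 < vol K)%E.
Proof.
move=> cK [c /nbhs_ballP[e /= e0 eK]].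
have e20 : 0 < e / 2 by rewrite divr_gt0.
apply: (@lt_le_trans _ _ ((2 * (e / 2)) ^+ n)%:E).
  by rewrite lte_fin exprn_gt0// mulr_gt0.
rewrite -(vol_box c e20); apply: le_vol => //; first exact: closed_box.
move=> v h; apply: eK; split => // i j; rewrite ord1 -ball_normE/=.
have := h i; rewrite in_itv/= => /andP[h1 h2].
by rewrite ltr_norml; apply/andP; split; lra.
Qed.

(** * Determinants and traces *)

(** The Gram matrix is Hermitian, hence normal, and the spectral theorem over a closed field turns
    determinant and trace into the product and the sum of its eigenvalues. The real case follows by
    embedding R into R[i]. *)
Lemma det_conj_gram_le (C : numClosedFieldType) (n : nat) (A : 'M[C]_n) :
  \det (A ^t Num.conj *m A)%sesqui <= (\tr (A ^t Num.conj *m A)%sesqui / n%:R) ^+ n.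
Proof.
set S := (X in \det X).
have nS : S \is normalmx.
  apply/normalmxP.
  have -> : (S ^t Num.conj)%sesqui = S.
    by rewrite /S trmx_mul map_mxM/= map_trmx trmxK -map_mx_comp (map_mx_id (@conjCK _)).
  by [].
set P := spectralmx S; set d := spectral_diag S.
have uP : P \in unitmx by exact: spectral_unit.
have SE : S = invmx P *m diag_mx d *m P by exact/orthomx_spectralP.
have d0 i : 0 <= d 0 i.
  (* As P is unitary, the diagonal matrix is itself a Gram matrix, so its diagonal entries are sums
     of squared moduli. *)
  have E : diag_mx d = ((A *m invmx P) ^t Num.conj)%sesqui *m (A *m invmx P).
    have iP : invmx P = (P ^t Num.conj)%sesqui by rewrite invmx_unitary// spectral_unitarymx.
    have -> : diag_mx d = P *m S *m invmx P.
      by rewrite SE !mulmxA mulmxV// mul1mx -mulmxA mulmxV// mulmx1.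
    rewrite trmx_mul map_mxM/= /S !mulmxA; congr (_ *m _ *m _ *m _).
    by rewrite iP; apply/matrixP => k l; rewrite !mxE conjCK.
  have -> : d 0 i = diag_mx d i i by rewrite mxE eqxx mulr1n.
  rewrite E mxE; apply: sumr_ge0 => k _; rewrite !mxE mulrC; exact: mul_conjC_ge0.
have -> : \det S = \prod_(i in 'I_n) d 0 i.
  by rewrite SE !det_mulmx det_inv mulrAC mulVr ?mul1r ?det_diag// -unitmxE.
have -> : \tr S = \sum_(i in 'I_n) d 0 i.
  by rewrite SE -mulmxA mxtrace_mulC -mulmxA mulmxV// mulmx1 mxtrace_diag.
have [+ _] := leif_AGM (A := 'I_n) (E := d 0) (fun i _ => d0 i).
by rewrite card_ord.
Qed.

Lemma det_sqr_le (R : rcfType) (n : nat) (A : 'M[R]_n) :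
  (\det A) ^+ 2 <= (\tr (A^T *m A) / n%:R) ^+ n.
Proof.
pose f : {rmorphism R -> R[i]} := real_complex R.
have E : ((map_mx f A) ^t Num.conj)%sesqui = map_mx f A^T.
  by apply/matrixP => i j; rewrite !mxE; apply: conjc_real.
have := det_conj_gram_le (map_mx f A).
rewrite E -map_mxM !det_map_mx trace_map_mx -(rmorph_nat f) -fmorph_div -rmorphXn/= lecR.
by rewrite det_mulmx det_tr.
Qed.

(** * Reduction of conic combinations of symmetric matrices *)

Lemma card_ltri (n : nat) : #|[pred p : 'I_n * 'I_n | p.1 <= p.2]%N| = 'C(n.+1, 2).
Proof.
rewrite -sum1_card /= (eq_bigl (fun p : 'I_n * 'I_n => true && (p.1 <= p.2)%N))//.
rewrite -(pair_big_dep xpredT (fun i j : 'I_n => (i <= j)%N) (fun _ _ => 1%N))/=.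
rewrite (exchange_big_dep xpredT)//= -bin2_sum big_mkord big_ord_recl/= add0n.
apply: eq_bigr => j _; rewrite -(big_ord_widen n (fun=> 1%N) (ltn_ord j)).
by rewrite sum_nat_const card_ord muln1.
Qed.

(** A symmetric matrix is determined by its entries on and above the diagonal. The family has one
    member more than there are such entries, so the matrix M of these coordinates has a nonzero left
    kernel. *)
Lemma sym_dependent (F : fieldType) (n : nat) (S : 'I_('C(n.+1, 2)).+1 -> 'M[F]_n) :
  (forall k, (S k)^T = S k) ->
  exists2 c : 'I_('C(n.+1, 2)).+1 -> F, (exists k, c k != 0) & \sum_k c k *: S k = 0.
Proof.
move=> Ssym; pose T := {p : 'I_n * 'I_n | (p.1 <= p.2)%N}.
have cT : #|{: T}| = 'C(n.+1, 2) by rewrite card_sig card_ltri.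
pose M : 'M[F]_(('C(n.+1, 2)).+1, #|{: T}|) :=
  \matrix_(k, q) S k (val (enum_val q)).1 (val (enum_val q)).2.
have : kermx M != 0.
  rewrite kermx_eq0 /row_free neq_ltn; apply/orP; left.
  by rewrite ltnS (leq_trans (rank_leq_col M))// cT.
case/rowV0Pn => c /sub_kermxP cM /rV0Pn[k ck].
exists (c 0); first by exists k.
have low (i j : 'I_n) : (i <= j)%N -> \sum_k c 0 k * S k i j = 0.
  move=> ij; pose q := enum_rank (exist _ (i, j) ij : T).
  transitivity ((c *m M) 0 q); last by rewrite cM mxE.
  rewrite mxE.
  by apply: eq_bigr => l _; rewrite mxE enum_rankK.
apply/matrixP => i j; rewrite summxE mxE.
under eq_bigr do rewrite mxE.
have [ij|ji] := leqP i j; first exact: low.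
rewrite -[RHS](low j i (ltnW ji)); apply: eq_bigr => l _.
by rewrite -{1}(Ssym l) mxE.
Qed.

(* Caratheodory's argument for cones: move along the linear relation [c] until
   the first coefficient vanishes. *)
Lemma conic_reduction (F : realFieldType) (V : lmodType F) (N : nat) (S : 'I_N.+1 -> V)
    (l c : 'I_N.+1 -> F) :
  (forall k, 0 <= l k) -> (exists k, c k != 0) -> \sum_k c k *: S k = 0 ->
  exists (k0 : 'I_N.+1) (l' : 'I_N.+1 -> F),
    [/\ forall k, 0 <= l' k, l' k0 = 0 & \sum_k l' k *: S k = \sum_k l k *: S k].
Proof.
move=> l0 cn0 cS.
wlog [k1 ck1] : c cn0 cS / exists k, 0 < c k.
  move=> wl; have [k ck] := cn0; have := ck; rewrite neq_lt => /orP[ckn|ckp].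
    apply: (wl (fun k => - c k)).
    - by exists k; rewrite oppr_eq0.
    - by under eq_bigr do rewrite scaleNr; rewrite sumrN cS oppr0.
    - by exists k; rewrite oppr_gt0.
  by apply: (wl c) => //; exists k.
(* The smallest ratio l / c over positive c is the longest step along the relation that keeps every
   coefficient nonnegative. *)
pose k0 := [arg min_(i < k1 | 0 < c i) (l i / c i)]%O.
have [ck0 min0] : 0 < c k0 /\ forall j, 0 < c j -> l k0 / c k0 <= l j / c j.
  by rewrite /k0; case: arg_minP.
exists k0, (fun k => l k - l k0 / c k0 * c k); split.
- move=> k; rewrite subr_ge0; have [ckp|ckn] := ltP 0 (c k).
    by rewrite -ler_pdivlMr//; exact: min0.
  by rewrite (le_trans _ (l0 k))// mulr_ge0_le0// divr_ge0// ltW.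
- by rewrite divfK ?subrr// gt_eqF.
- under eq_bigr do rewrite scalerBl -scalerA.
  by rewrite sumrB -scaler_sumr cS scaler0 subr0.
Qed.

(** * The nearest point of the cone to the identity *)

(** The Frobenius inner product; on column vectors it is the Euclidean one, so the same bilinear
    rules serve matrices and points. *)
Definition fdot (R : realType) (m n : nat) (A B : 'M[R]_(m, n)) : R := \tr (A^T *m B).

Section FrobeniusProduct.
Variables (R : realType) (m n : nat).
Implicit Types (A B C : 'M[R]_(m, n)) (a : R).

Lemma fdotE A B : fdot A B = \sum_j \sum_i A i j * B i j.
Proof. by apply: eq_bigr => j _; rewrite mxE; apply: eq_bigr => i _; rewrite mxE. Qed.

Lemma fdotC A B : fdot A B = fdot B A.
Proof. by rewrite /fdot -mxtrace_tr trmx_mul trmxK. Qed.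

Lemma fdotDr A B C : fdot A (B + C) = fdot A B + fdot A C.
Proof. by rewrite /fdot mulmxDr raddfD. Qed.

Lemma fdotZr a A B : fdot A (a *: B) = a * fdot A B.
Proof. by rewrite /fdot -scalemxAr mxtraceZ. Qed.

Lemma fdotDl A B C : fdot (B + C) A = fdot B A + fdot C A.
Proof. by rewrite fdotC fdotDr !(fdotC A). Qed.

Lemma fdotZl a A B : fdot (a *: B) A = a * fdot B A.
Proof. by rewrite fdotC fdotZr (fdotC A). Qed.

Lemma fdot_ge0 A : 0 <= fdot A A.
Proof.
by rewrite fdotE; apply: sumr_ge0 => j _; apply: sumr_ge0 => i _; rewrite -expr2 sqr_ge0.
Qed.

Lemma fdot_eq0 A : fdot A A = 0 -> A = 0.
Proof.
move=> A0; apply/matrixP => i j; rewrite mxE; apply/eqP; rewrite -sqrf_eq0; apply/eqP.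
have : forall j, true -> 0 <= \sum_i A i j * A i j.
  by move=> k _; apply: sumr_ge0 => l _; rewrite -expr2 sqr_ge0.
move: A0; rewrite fdotE => A0 /psumr_eq0P/(_ A0 j isT) /psumr_eq0P h.
by rewrite expr2; apply: h => // k _; rewrite -expr2 sqr_ge0.
Qed.

Lemma continuous_fdot (T : topologicalType) (f g : T -> 'M[R]_(m, n)) :
  (forall i j, continuous (fun t => f t i j)) ->
  (forall i j, continuous (fun t => g t i j)) ->
  continuous (fun t => fdot (f t) (g t)).
Proof.
move=> cf cg; under eq_fun do rewrite fdotE.
by do 2!apply: continuous_sumr => ?; apply: continuous_mulr.
Qed.

End FrobeniusProduct.

Lemma fdot1r (R : realType) (n : nat) (A : 'M[R]_n) : fdot A 1%:M = \tr A.
Proof. by rewrite /fdot mulmx1 mxtrace_tr. Qed.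

Lemma fdot_outer (R : realType) (n : nat) (A : 'M[R]_n) (u : 'cV[R]_n) :
  fdot A (u *m u^T) = (u^T *m A *m u) 0 0.
Proof.
rewrite /fdot mulmxA mxtrace_mulC trace_mx11 mulmxA.
have -> : u^T *m A *m u = (u^T *m A^T *m u)^T by rewrite !trmx_mul !trmxK mulmxA.
by rewrite [RHS]mxE.
Qed.

Lemma tr_outer (R : realType) (n : nat) (u : 'cV[R]_n) : \tr (u *m u^T) = fdot u u.
Proof. by rewrite mxtrace_mulC. Qed.

(** Cauchy-Schwarz for A and the identity, read off from the squared norm of n A - (tr A) 1. *)
Lemma trace_sqr_le (R : realType) (n : nat) (A : 'M[R]_n) :
  (\tr A) ^+ 2 <= n%:R * fdot A A.
Proof.
case: n A => [|n] A; first by rewrite /mxtrace big_ord0 expr0n mul0r.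
have := fdot_ge0 (n.+1%:R *: A + (- \tr A) *: 1%:M).
rewrite !(fdotDl, fdotDr, fdotZl, fdotZr) fdot1r (fdotC 1%:M) fdot1r.
rewrite fdot1r mxtrace1 => h.
have n0 : 0 < n.+1%:R :> R by [].
rewrite -subr_ge0 -(pmulr_rge0 _ n0); apply: le_trans h _.
by rewrite le_eqVlt; apply/orP; left; apply/eqP; ring.
Qed.

(** The first order condition at a minimum of a squared distance along a segment: a is half the
    derivative at 0. *)
Lemma quadratic_lin_coef_ge0 (R : realFieldType) (a b : R) :
  0 <= b -> (forall e, 0 < e <= 1 -> 0 <= 2 * e * a + e ^+ 2 * b) -> 0 <= a.
Proof.
move=> b0 h; rewrite leNgt; apply/negP => a0.
have ba : 0 < b - a by rewrite subr_gt0 (lt_le_trans a0).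
(* For this e the factor 2 a + e b equals (1 + e) a < 0, while b >= 0 ensures e <= 1. *)
pose e := - a / (b - a).
have e0 : 0 < e by rewrite divr_gt0// oppr_gt0.
have e1 : e <= 1 by rewrite ler_pdivrMr// mul1r; lra.
have := h e; rewrite e0 e1 => /(_ isT).
have -> : 2 * e * a + e ^+ 2 * b = e * (2 * a + e * b) by ring.
rewrite pmulr_rge0// => h2.
have : e * (b - a) = - a by rewrite divfK// gt_eqF.
have : 0 < e * - a by rewrite mulr_gt0// oppr_gt0.
lra.
Qed.

(** Sequences over [nat], constrained only below k, let the same l and u serve for k and k + 1 in
    inductions. *)
Definition conic_sums (R : realType) (n : nat) (U : set 'cV[R]_n) (L : R) (k : nat)
    : set 'M[R]_n :=
  [set X | exists (l : nat -> R) (u : nat -> 'cV[R]_n),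
     (forall i, (i < k)%N -> (0 <= l i <= L) /\ U (u i)) /\
     X = \sum_(i < k) l i *: (u i *m (u i)^T)].

Lemma conic_sums_ord (R : realType) (n : nat) (U : set 'cV[R]_n) (L : R) (k : nat)
    (l : 'I_k -> R) (u : 'I_k -> 'cV[R]_n) :
  (forall i, 0 <= l i <= L) -> (forall i, U (u i)) ->
  conic_sums U L k (\sum_i l i *: (u i *m (u i)^T)).
Proof.
move=> hl hu; exists (fun i => oapp l 0 (insub i)), (fun i => oapp u 0 (insub i)); split.
  by move=> i ik; rewrite insubT; split; [exact: hl|exact: hu].
by apply: eq_bigr => i _; rewrite valK.
Qed.

Lemma compact_conic_sums (R : realType) (n : nat) (U : set 'cV[R]_n) (L : R) (k : nat) :
  compact U -> compact (conic_sums U L k).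
Proof.
move=> cU; elim: k => [|k IH].
  rewrite (_ : conic_sums U L 0 = [set 0]); first exact: compact_set1.
  apply/seteqP; split => X /=; first by move=> [l [u [_ ->]]]; rewrite big_ord0.
  by move=> ->; exists (fun=> 0), (fun=> 0); split => //; rewrite big_ord0.
pose f (p : 'M[R]_n * R * 'cV[R]_n) : 'M[R]_n := p.1.1 + p.1.2 *: (p.2 *m p.2^T).
have cf : continuous f.
  apply: continuous_mx => i j; rewrite /f.
  under eq_fun do rewrite 3!mxE big_ord1 mxE.
  apply: continuous_addr.
    move=> p; apply: (@continuous_comp _ _ _
      (fun p : 'M[R]_n * R * 'cV[R]_n => p.1.1) (fun X : 'M[R]_n => X i j)).
      by apply: (@continuous_comp _ _ _ fst fst); exact: cvg_fst.
    exact: coord_continuous.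
  apply: continuous_mulr.
    by move=> p; apply: (@continuous_comp _ _ _ fst snd); [exact: cvg_fst|exact: cvg_snd].
  by apply: continuous_mulr => p;
    apply: (@continuous_comp _ _ _ snd (fun X : 'cV[R]_n => X _ 0));
    [exact: cvg_snd|exact: coord_continuous|exact: cvg_snd|exact: coord_continuous].
have -> : conic_sums U L k.+1 = f @` ((conic_sums U L k `*` `[0, L]) `*` U).
  apply/seteqP; split => X /=.
    move=> [l [u [h ->]]]; exists (\sum_(i < k) l i *: (u i *m (u i)^T), l k, u k) => /=.
      split; last by have [] := h k (ltnSn k).
      split; last by have [] := h k (ltnSn k); rewrite in_itv.
      by exists l, u; split => // i ik; apply: h; exact: ltnW.
    by rewrite big_ord_recr.
  move=> [[[Y a] v] /= [[[l [u [h ->]]] aL] Uv] <-].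
  exists (fun i => if (i < k)%N then l i else a), (fun i => if (i < k)%N then u i else v).
  split; first by move=> i _; case: ifP => ik; [exact: h|move: aL; rewrite in_itv].
  rewrite /f /= big_ord_recr/= ltnn; congr (_ + _).
  by apply: eq_bigr => i _; rewrite ltn_ord.
apply: continuous_compact; first exact: continuous_subspaceT.
by apply: compact_setX => //; apply: compact_setX => //; exact: segment_compact.
Qed.

Section JohnAlternative.
Variables (R : realType) (n : nat) (U : set 'cV[R]_n).
Hypothesis unitU : forall u, U u -> fdot u u = 1.
Let N := 'C(n.+1, 2).
Let W (L : R) := conic_sums U L N.

Lemma tr_conic_sum (I : finType) (l : I -> R) (u : I -> 'cV[R]_n) :
  (forall i, U (u i)) -> \tr (\sum_i l i *: (u i *m (u i)^T)) = \sum_i l i.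
Proof.
move=> Uu; rewrite raddf_sum/=; apply: eq_bigr => i _.
by rewrite mxtraceZ tr_outer unitU// mulr1.
Qed.

(** The extra term is removed again by [conic_reduction]. Each u u^T has trace 1, so the new
    coefficients sum to tr P + e; being nonnegative, each of them is at most L. *)
Lemma conic_sums_add (L : R) (P : 'M[R]_n) (u : 'cV[R]_n) (e : R) :
  W L P -> U u -> 0 <= e -> \tr P + e <= L -> W L (P + e *: (u *m u^T)).
Proof.
move=> [l [v [h PE]]] Uu e0 tL.
pose l1 (k : 'I_N.+1) : R := if (k < N)%N then l k else e.
pose u1 (k : 'I_N.+1) : 'cV[R]_n := if (k < N)%N then v k else u.
have E : P + e *: (u *m u^T) = \sum_k l1 k *: (u1 k *m (u1 k)^T).
  rewrite big_ord_recr/= /l1 /u1/= ltnn PE; congr (_ + _).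
  by apply: eq_bigr => i _; rewrite ltn_ord.
have Uu1 k : U (u1 k) by rewrite /u1; case: ifP => // /h[].
have l10 k : 0 <= l1 k by rewrite /l1; case: ifP => // /h[/andP[]].
have [c cn0 c0] := sym_dependent (S := fun k => u1 k *m (u1 k)^T)
  (fun k => etrans (trmx_mul _ _) (congr1 (mulmx^~ _) (trmxK _))).
have [k0 [l2 [l20 l2k0 l2E]]] := conic_reduction l10 cn0 c0.
have l2s : \sum_k l2 k = \tr P + e.
  by rewrite -(tr_conic_sum l2 Uu1) l2E -E raddfD/= mxtraceZ tr_outer unitU// mulr1.
rewrite E -l2E (bigD1_ord k0)//= l2k0 scale0r add0r.
apply: (conic_sums_ord (l := fun i => l2 (lift k0 i)) (u := fun i => u1 (lift k0 i))).
  move=> i; rewrite l20/= (le_trans _ tL)// -l2s (bigD1 (lift k0 i))//= lerDl.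
  by apply: sumr_ge0 => j _; exact: l20.
by move=> i.
Qed.

Lemma conic_sums_scale (L : R) (P : 'M[R]_n) (e : R) :
  W L P -> 0 <= e <= 1 -> W L (e *: P).
Proof.
move=> [l [v [h ->]]] /andP[e0 e1]; exists (fun i => e * l i), v; split.
  move=> i /h[/andP[l0 lL] Uv]; split => //.
  by rewrite mulr_ge0//= (le_trans _ lL)// ler_piMl.
by rewrite scaler_sumr; apply: eq_bigr => i _; rewrite scalerA.
Qed.

(* If the identity is not in the cone spanned by the uu^T, a separating H is
   obtained from the vector joining its nearest point P in the cone to the
   identity. The bound L on the coefficients makes the set of candidates compact;
   it is not active at P, because tr P <= n. *)
Lemma john_alternative : (0 < n)%N -> compact U -> U !=set0 ->
  (exists (l : 'I_N -> R) (u : 'I_N -> 'cV[R]_n),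
     [/\ forall i, 0 <= l i, forall i, U (u i) &
         1%:M = \sum_i l i *: (u i *m (u i)^T)]) \/
  (exists (H : 'M[R]_n) (d : R),
     [/\ 0 < d, 0 < \tr H & forall u, U u -> (u^T *m H *m u) 0 0 <= - d]).
Proof.
(* The summand 1 on top of the bound n for tr P leaves room for a further term e u u^T with e <=
   1. *)
move=> n0 cU [u0 Uu0]; pose L : R := n%:R + 1.
have L0 : 0 <= L by rewrite addr_ge0.
pose f (X : 'M[R]_n) := fdot (1%:M - X) (1%:M - X).
have cf : continuous f.
  have c1 i j : continuous (fun X : 'M[R]_n => (1%:M - X) i j).
    under eq_fun do rewrite !mxE.
    apply: continuous_addr; first exact: cst_continuous.
    apply: continuous_oppr; exact: coord_continuous.
  exact: continuous_fdot.
have W0 : W L !=set0.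
  exists (\sum_(i < N) 0 *: (u0 *m u0^T)).
  by apply: (conic_sums_ord (l := fun=> 0) (u := fun=> u0)) => // i; rewrite lexx L0.
have [P /set_mem WP minP] := compact_EVT_min W0 (compact_conic_sums (L := L) (k := N) cU)
  (continuous_subspaceT cf).
have [H HE] : exists H, H = 1%:M - P by exists (1%:M - P).
have HP : 0 <= fdot H P.
  apply: (quadratic_lin_coef_ge0 (fdot_ge0 P)) => e /andP[e0 e1].
  have := minP ((1 - e) *: P); rewrite mem_set; last first.
    by apply: conic_sums_scale => //; rewrite subr_ge0 e1 lerBlDr lerDl ltW.
  move=> /(_ isT); rewrite /f -HE.
  have -> : 1%:M - (1 - e) *: P = H + e *: P.
    by rewrite scalerBl scale1r opprB HE -addrA (addrC (- P)).
  by rewrite !(fdotDl, fdotDr, fdotZl, fdotZr) (fdotC P H) => h; lra.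
have trP0 : 0 <= \tr P.
  move: WP => [l [v [h ->]]]; rewrite tr_conic_sum; last by move=> i; have [] := h i (ltn_ord i).
  by apply: sumr_ge0 => i _; have [/andP[]] := h i (ltn_ord i).
(* [HP] says that [fdot P P] is at most tr P, and (tr P)^2 <= n [fdot P P]. *)
have trP : \tr P <= n%:R.
  have [->|tn0] := eqVneq (\tr P) 0; first by rewrite ler0n.
  have tp : 0 < \tr P by rewrite lt_neqAle eq_sym tn0.
  rewrite -(ler_pM2r tp) -expr2 (le_trans (trace_sqr_le P))//.
  rewrite ler_pM2l ?ltr0n//.
  by move: HP; rewrite HE fdotDl -scaleN1r fdotZl (fdotC 1%:M) fdot1r; lra.
have Hu u : U u -> fdot H (u *m u^T) <= 0.
  move=> Uu; rewrite -oppr_ge0.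
  apply: (quadratic_lin_coef_ge0 (fdot_ge0 (u *m u^T))) => e /andP[e0 e1].
  have := minP (P + e *: (u *m u^T)); rewrite mem_set; last first.
    by apply: conic_sums_add => //; [exact: ltW|exact: lerD].
  move=> /(_ isT); rewrite /f -HE opprD addrA -HE -scaleNr.
  by rewrite !(fdotDl, fdotDr, fdotZl, fdotZr) (fdotC (u *m u^T) H) => h; lra.
have [H0|H0] := eqVneq (fdot H H) 0.
  left; move: WP => [l [v [h PE]]]; exists (fun i => l i), (fun i => v i); split.
  - by move=> i; have [/andP[]] := h i (ltn_ord i).
  - by move=> i; have [] := h i (ltn_ord i).
  - by rewrite -PE; apply/eqP; rewrite -subr_eq0 -HE (fdot_eq0 H0).
right.
have trH : 0 < \tr H.
  have -> : \tr H = fdot H H + fdot H P by rewrite -fdotDr HE subrK fdot1r.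
  by rewrite ltr_wpDr// lt_neqAle eq_sym H0 fdot_ge0.
have nn : 0 < n%:R :> R by rewrite ltr0n.
(* Subtracting d times the identity pushes the nonpositive values u^T H u down to at most - d and
   only halves the trace. *)
pose d := \tr H / (2 * n%:R).
exists (H + (- d) *: 1%:M), d; split.
- by rewrite divr_gt0// mulr_gt0.
- rewrite raddfD/= mxtraceZ mxtrace1 /d.
  rewrite (_ : - _ * _ = - (\tr H / 2)); last by field; rewrite gt_eqF.
  lra.
- move=> u Uu; rewrite -fdot_outer fdotDl fdotZl (fdotC 1%:M) fdot1r tr_outer unitU//.
  by rewrite mulr1 gerDr Hu.
Qed.

End JohnAlternative.

(** * Perturbation of the identity *)

Lemma continuous_qform (R : realType) (n : nat) (H : 'M[R]_n) :
  continuous (fun x : 'cV[R]_n => (x^T *m H *m x) 0 0).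
Proof.
under eq_fun do rewrite -fdot_outer.
apply: continuous_fdot => i j; first exact: cst_continuous.
under eq_fun do rewrite mxE big_ord1 mxE.
by apply: continuous_mulr; exact: coord_continuous.
Qed.

Lemma continuous_fdot_self (R : realType) (m n : nat) :
  continuous (fun x : 'M[R]_(m, n) => fdot x x).
Proof. by apply: continuous_fdot => i j; exact: coord_continuous. Qed.

Lemma fdot_perturb (R : realType) (n : nat) (H : 'M[R]_n) (t : R) (x : 'cV[R]_n) :
  fdot ((1%:M + t *: H) *m x) ((1%:M + t *: H) *m x) =
  fdot x x + 2 * t * (x^T *m H *m x) 0 0 + t ^+ 2 * fdot (H *m x) (H *m x).
Proof.
have E : fdot x (H *m x) = (x^T *m H *m x) 0 0 by rewrite /fdot trace_mx11 mulmxA.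
rewrite mulmxDl mul1mx -scalemxAl !(fdotDl, fdotDr, fdotZl, fdotZr) (fdotC (H *m x) x) E.
ring.
Qed.

Lemma compact_upper_bound (R : realType) (T : topologicalType) (A : set T) (f : T -> R) :
  compact A -> continuous f -> exists2 M, 0 < M & forall x, A x -> f x <= M.
Proof.
move=> cA cf; have [A0|] := pselect (A !=set0); last first.
  by move=> A0; exists 1 => // x Ax; case: A0; exists x.
have [c _ h] := compact_EVT_max A0 cA (continuous_subspaceT cf).
exists (`|f c| + 1); first by rewrite ltr_wpDl.
move=> x Ax; rewrite (le_trans (h x _)) ?mem_set// (le_trans (ler_norm _))//.
by rewrite lerDl.
Qed.

Lemma compact_lt_gap (R : realType) (T : topologicalType) (A : set T) (f : T -> R) (b : R) :
  compact A -> continuous f -> (forall x, A x -> f x < b) ->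
  exists2 e, 0 < e & forall x, A x -> f x <= b - e.
Proof.
move=> cA cf fb; have [A0|] := pselect (A !=set0); last first.
  by move=> A0; exists 1 => // x Ax; case: A0; exists x.
have [c /set_mem Ac h] := compact_EVT_max A0 cA (continuous_subspaceT cf).
exists (b - f c); first by rewrite subr_gt0 fb.
by move=> x Ax; rewrite opprB addrC subrK h// mem_set.
Qed.

Lemma compact_closed_cond (R : realType) (T : topologicalType) (A : set T) (f : T -> R) (b : R) :
  compact A -> continuous f -> compact [set x | A x /\ b <= f x].
Proof.
move=> cA cf; apply: (@compact_closedI _ A [set x | b <= f x]) => //.
exact: (continuous_closedP _).1 cf _ (@closed_ge _ b).
Qed.

(** C is split by the value of q(x) = x^T H x. Where q < - d / 2, the linear term in t beats the
    quadratic one as soon as t M <= d. The rest of C is compact and misses the unit sphere, so |x|^2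
    <= 1 - e there, and this slack absorbs both terms once t (2 M' + M) <= e. *)
Lemma ball_perturbation (R : realType) (n : nat) (C : set 'cV[R]_n) (H : 'M[R]_n) (d : R) :
  compact C -> (forall x, C x -> fdot x x <= 1) -> 0 < d ->
  (forall x, C x -> fdot x x = 1 -> (x^T *m H *m x) 0 0 <= - d) ->
  exists2 t0 : R, 0 < t0 &
    forall t, 0 < t <= t0 -> forall x, C x ->
      fdot ((1%:M + t *: H) *m x) ((1%:M + t *: H) *m x) <= 1.
Proof.
move=> cC C1 d0 Hd.
pose q (x : 'cV[R]_n) := (x^T *m H *m x) 0 0.
have [M M0 HM] : exists2 M, 0 < M & forall x, C x -> fdot (H *m x) (H *m x) <= M.
  apply: compact_upper_bound => //.
  by apply: continuous_fdot => i j; exact: continuous_mulmx_coord.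
have [M' M'0 HM'] := compact_upper_bound cC (continuous_qform (H := H)).
have cC' := compact_closed_cond (b := - d / 2) cC (continuous_qform (H := H)).
have [|e e0 He] := compact_lt_gap (b := 1) cC' (continuous_fdot_self (m := n) (n := 1)).
  move=> x [Cx qx]; rewrite lt_neqAle C1// andbT; apply/eqP => x1.
  by have := Hd x Cx x1; lra.
pose t0 := Num.min 1 (Num.min (d / M) (e / (2 * M' + M))).
have MM : 0 < 2 * M' + M by rewrite addr_gt0// mulr_gt0.
exists t0; first by rewrite !lt_min ltr01 !divr_gt0.
move=> t /andP[tp]; rewrite !le_min => /and3P[t1 tdM te] x Cx.
rewrite fdot_perturb -/(q x).
have tM : t ^+ 2 * fdot (H *m x) (H *m x) <= t ^+ 2 * M.
  by rewrite ler_pM2l ?exprn_gt0// HM.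
have [qd|qd] := leP (- d / 2) (q x).
  have h1 : fdot x x <= 1 - e by exact: He.
  have h2 : t * q x <= t * M' by rewrite ler_pM2l// HM'.
  have h3 : t ^+ 2 * M <= t * M.
    by rewrite ler_pM2r// expr2 -[leRHS]mulr1 ler_pM2l.
  have : t * (2 * M' + M) <= e by rewrite -ler_pdivlMr.
  rewrite -mulrA; lra.
have h1 := C1 x Cx.
have h2 : t * q x < t * (- d / 2) by rewrite ltr_pM2l.
have h3 : t ^+ 2 * M <= t * d.
  by rewrite expr2 -mulrA ler_pM2l// -ler_pdivlMr.
rewrite -mulrA; lra.
Qed.

Lemma horner_char_poly (R : comNzRingType) (n : nat) (A : 'M[R]_n) (x : R) :
  (char_poly A).[x] = \det (x%:M - A).
Proof.
rewrite -horner_evalE -det_map_mx; congr (\det _); apply/matrixP => i j.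
by rewrite !mxE/= /horner_eval !(hornerE, hornerMn).
Qed.

(* det (1 + t H) = t^n chi(1/t), where chi is the characteristic polynomial of
   - H, whose coefficient of degree n - 1 is tr H. *)
Lemma det_one_add_ge (R : realFieldType) (n : nat) (H : 'M[R]_n) : (0 < n)%N ->
  exists B : R, forall t, 0 < t <= 1 ->
    1 + t * \tr H - t ^+ 2 * B <= \det (1%:M + t *: H).
Proof.
case: n H => // n H _; pose p := char_poly (- H).
exists (\sum_(i < n) `|p`_i|) => t /andP[t0 t1].
have tn0 : t != 0 by rewrite gt_eqF.
have -> : \det (1%:M + t *: H) = t ^+ n.+1 * p.[t^-1].
  rewrite horner_char_poly opprK -detZ scalerDr; congr (\det (_ + _)).
  by rewrite scale_scalar_mx divff.
rewrite horner_coef size_char_poly 2!big_ord_recr/= mulrDr mulrDr.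
have -> : p`_n.+1 = 1.
  by have /monicP := char_poly_monic (- H); rewrite lead_coefE size_char_poly.
have -> : p`_n = \tr H by have := char_poly_trace (- H) isT; rewrite raddfN/= opprK.
rewrite mul1r -exprMn divff// expr1n.
have -> : t ^+ n.+1 * (\tr H * t^-1 ^+ n) = t * \tr H.
  by rewrite exprS mulrCA -mulrA -exprMn divff// expr1n mulr1 mulrC.
suff : - (t ^+ 2 * \sum_(i < n) `|p`_i|) <= t ^+ n.+1 * \sum_(i < n) p`_i * t^-1 ^+ i.
  move: (t ^+ 2 * _) (t ^+ n.+1 * _) (t * _) => x y z; lra.
rewrite -mulrN -sumrN !mulr_sumr; apply: ler_sum => i _.
(* The size is n + 1 and i < n, so t^(n+1-i) contains a factor t^2, and the remaining power of t is
   at most 1. *)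
have -> : t ^+ n.+1 = t ^+ 2 * t ^+ (n - i.+1) * t ^+ i.
  by rewrite -!exprD add2n addSn addSnnS subnK.
rewrite (_ : _ * (p`_i * _) = t ^+ 2 * (t ^+ (n - i.+1) * p`_i)); last first.
  have : t ^+ i * t^-1 ^+ i = 1 by rewrite -exprMn divff// expr1n.
  move: (t ^+ i) (t^-1 ^+ i) (t ^+ (n - i.+1)) => x y z xy.
  by rewrite -[RHS]mulr1 -xy; ring.
rewrite ler_pM2l ?exprn_gt0// lerNl -mulrN (le_trans (ler_norm _))// normrM normrN ler_piMl//.
rewrite ger0_norm; last by rewrite exprn_ge0// ltW.
by rewrite exprn_ile1// ltW.
Qed.

(** * Euclidean norm and unit ball *)

Lemma fdot_cV (R : realType) (n : nat) (x : 'cV[R]_n) : fdot x x = \sum_i x i 0 ^+ 2.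
Proof. by rewrite fdotE big_ord1; apply: eq_bigr => i _; rewrite expr2. Qed.

Lemma enormE (R : realType) (n : nat) (x : 'cV[R]_n) : enorm x = Num.sqrt (fdot x x).
Proof. by rewrite fdot_cV. Qed.

Lemma enorm_ge0 (R : realType) (n : nat) (x : 'cV[R]_n) : 0 <= enorm x.
Proof. exact: sqrtr_ge0. Qed.

Lemma enorm_sqr (R : realType) (n : nat) (x : 'cV[R]_n) : enorm x ^+ 2 = fdot x x.
Proof. by rewrite enormE sqr_sqrtr// fdot_ge0. Qed.

Lemma enorm_le (R : realType) (n : nat) (x : 'cV[R]_n) (r : R) :
  0 <= r -> (enorm x <= r) = (fdot x x <= r ^+ 2).
Proof. by move=> r0; rewrite -enorm_sqr ler_pXn2r ?nnegrE ?enorm_ge0. Qed.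

Lemma enorm_le1 (R : realType) (n : nat) (x : 'cV[R]_n) : (enorm x <= 1) = (fdot x x <= 1).
Proof. by rewrite enorm_le// expr1n. Qed.

Lemma enorm_eq1 (R : realType) (n : nat) (x : 'cV[R]_n) : enorm x = 1 <-> fdot x x = 1.
Proof.
split; first by rewrite -enorm_sqr => ->; rewrite expr1n.
by rewrite enormE => ->; rewrite sqrtr1.
Qed.

Lemma enormZ (R : realType) (n : nat) (a : R) (x : 'cV[R]_n) : enorm (a *: x) = `|a| * enorm x.
Proof.
by rewrite !enormE fdotZl fdotZr mulrA -expr2 sqrtrM ?sqr_ge0// sqrtr_sqr.
Qed.

Lemma enormN (R : realType) (n : nat) (x : 'cV[R]_n) : enorm (- x) = enorm x.
Proof. by rewrite -scaleN1r enormZ normrN1 mul1r. Qed.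

Lemma enorm_gt0 (R : realType) (n : nat) (x : 'cV[R]_n) : x != 0 -> 0 < enorm x.
Proof.
move=> x0; rewrite lt_neqAle enorm_ge0 andbT eq_sym; apply: contra x0 => /eqP ex.
by apply/eqP/fdot_eq0; rewrite -enorm_sqr ex expr0n.
Qed.

(** The parallelogram identity without the term |x + y|^2. For a common bound on x and y it replaces
    the triangle inequality. *)
Lemma fdot_sub_le (R : realType) (n : nat) (x y : 'cV[R]_n) :
  fdot (x - y) (x - y) <= 2 * (fdot x x + fdot y y).
Proof.
have := fdot_ge0 (x + y).
rewrite -scaleN1r !(fdotDl, fdotDr, fdotZl, fdotZr) (fdotC y x) => h; lra.
Qed.

Lemma enorm_sub_le (R : realType) (n : nat) (x y : 'cV[R]_n) (r : R) :
  enorm x <= r -> enorm y <= r -> enorm (x - y) <= 2 * r.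
Proof.
move=> xr yr; have r0 : 0 <= r := le_trans (enorm_ge0 x) xr.
rewrite enorm_le ?mulr_ge0// (le_trans (fdot_sub_le x y))//.
by move: xr yr; rewrite !enorm_le// exprMn => xr yr; lra.
Qed.

Lemma convex_setP (R : realType) (n : nat) (A : set 'cV[R]_n) :
  convex_set A <->
  (forall x y t, 0 <= t <= 1 -> A x -> A y -> A (t *: x + (1 - t) *: y)).
Proof.
split=> [cA x y t /andP[t0 t1] Ax Ay|cA x y t /set_mem Ax /set_mem Ay].
  by have /set_mem := cA x y (Itv01 t0 t1) (mem_set Ax) (mem_set Ay).
by apply/mem_set; apply: cA => //; rewrite ge0 le1.
Qed.

Lemma convex_eball (R : realType) (n : nat) : convex_set (@eball R n).
Proof.
apply/convex_setP => x y t /andP[t0 t1]; rewrite /eball/= !enorm_le1 => x1 y1.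
(* t |x|^2 + (1 - t) |y|^2 - |t x + (1 - t) y|^2 = t (1 - t) |x - y|^2. *)
have := fdot_ge0 (x - y).
rewrite -scaleN1r !(fdotDl, fdotDr, fdotZl, fdotZr) (fdotC y x) => h.
have h2 : 0 <= t * (1 - t) by rewrite mulr_ge0// subr_ge0.
have := mulr_ge0 h2 h.
have : t * fdot x x <= t * 1 by rewrite ler_wpM2l.
have : (1 - t) * fdot y y <= (1 - t) * 1 by rewrite ler_wpM2l// subr_ge0.
move: (fdot x x) (fdot y y) (fdot x y) => a b c; lra.
Qed.

Lemma convex_preimage_linear (R : realType) (n : nat) (A : 'M[R]_n) (C : set 'cV[R]_n) :
  convex_set C -> convex_set [set x : 'cV[R]_n | C (A *m x)].
Proof.
move=> /convex_setP cC; apply/convex_setP => x y t t01 /= Cx Cy.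
by rewrite mulmxDr -!scalemxAr; exact: cC.
Qed.

Lemma closed_eball (R : realType) (n : nat) : closed (@eball R n).
Proof.
have -> : @eball R n = (fun x => fdot x x) @^-1` [set r | r <= 1].
  by apply/seteqP; split => x; rewrite /eball/= enorm_le1.
exact: (continuous_closedP _).1 (@continuous_fdot_self R n 1) _ (@closed_le _ 1).
Qed.

Lemma vol_eball_fin (R : realType) (n : nat) : (vol (@eball R n) < +oo)%E.
Proof.
apply: (vol_bounded_fin (M := 1) (@closed_eball R n)) => x.
rewrite /eball/= enorm_le1 fdot_cV => x1 i.
rewrite -(@ler_pXn2r _ 2)// ?nnegrE// expr1n real_normK ?num_real//.
rewrite (le_trans _ x1)// (bigD1 i)//= lerDl.
by apply: sumr_ge0 => j _; exact: sqr_ge0.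
Qed.

Lemma vol_eball_gt0 (R : realType) (n : nat) : (0 < vol (@eball R n))%E.
Proof.
apply: vol_interior_gt0; first exact: closed_eball.
exists 0; apply: (@filterS _ _ _ ((fun x => fdot x x) @^-1` [set r | r < 1])).
  by move=> x /= x1; rewrite /eball/= enorm_le1 ltW.
apply: open_nbhs_nbhs; split.
  exact: (continuousP _).1 (@continuous_fdot_self R n 1) _ (@open_lt _ 1).
by rewrite /= fdot_cV big1// => i _; rewrite mxE expr0n.
Qed.

(** * Difference bodies and diameters *)

Lemma compact_linear_image (R : realType) (n : nat) (A : 'M[R]_n) (K : set 'cV[R]_n) :
  compact K -> compact (linear_image A K).
Proof.
move=> cK; apply: continuous_compact => //; apply: continuous_subspaceT.
apply: continuous_mx => i j; exact: continuous_mulmx_coord.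
Qed.

Lemma compact_difference_body (R : realType) (n : nat) (K : set 'cV[R]_n) :
  compact K -> compact (difference_body K).
Proof.
move=> cK; pose f (p : 'cV[R]_n * 'cV[R]_n) := p.1 - p.2.
have -> : difference_body K = f @` (K `*` K).
  apply/seteqP; split => z /=; first by move=> [x Kx [y Ky <-]]; exists (x, y).
  by move=> [[x y] [Kx Ky] <-]; exists x => //; exists y.
apply: continuous_compact; last exact: compact_setX.
apply: continuous_subspaceT => p; apply: cvgB; [exact: cvg_fst|exact: cvg_snd].
Qed.

Lemma compact_dilate (R : realType) (n : nat) (a : R) (K : set 'cV[R]_n) :
  compact K -> compact (dilate a K).
Proof.
move=> cK; apply: continuous_compact => //; apply: continuous_subspaceT.
apply: continuous_mx => i j; under eq_fun do rewrite mxE.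
apply: continuous_mulr; first exact: cst_continuous.
exact: coord_continuous.
Qed.

Lemma difference_bodyN (R : realType) (n : nat) (K : set 'cV[R]_n) z :
  difference_body K z -> difference_body K (- z).
Proof. by move=> [x Kx [y Ky <-]]; exists y => //; exists x => //; rewrite opprB. Qed.

Lemma difference_body_linear_image (R : realType) (n : nat) (A : 'M[R]_n) (K : set 'cV[R]_n) :
  difference_body (linear_image A K) = linear_image A (difference_body K).
Proof.
apply/seteqP; split => z.
  move=> [_ [x Kx <-] [_ [y Ky <-] <-]]; exists (x - y); last by rewrite mulmxBr.
  by exists x => //; exists y.
move=> [_ [x Kx [y Ky <-]] <-]; exists (A *m x); first by exists x.
by exists (A *m y); [exists y|rewrite mulmxBr].
Qed.

Lemma interior_difference_body (R : realType) (n : nat) (K : set 'cV[R]_n) :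
  K° !=set0 -> (difference_body K)° !=set0.
Proof.
move=> [c cK]; exists 0.
have Kc : K c := nbhs_singleton cK.
move/nbhs_ballP: cK => [e /= e0 eK].
apply/nbhs_ballP; exists e => //= z [_ ze]; exists (c + z).
  apply: eK; split => // i j; have := ze i j; rewrite -!ball_normE/= !mxE sub0r.
  by rewrite opprD addrA subrr sub0r.
by exists c => //; rewrite addrC addKr.
Qed.

Section Diameter.
Variables (R : realType) (n : nat) (K : set 'cV[R]_n).
Hypotheses (cK : compact K) (K0 : K !=set0).

(** From here on [diam K] is handled as the radius of the smallest ball about the origin containing
    K - K. *)
Lemma diam_attained : exists2 z, difference_body K z & enorm z = diam K.
Proof.
have D0 : difference_body K !=set0.
  by have [x Kx] := K0; exists (x - x), x => //; exists x.
have [z /set_mem Dz maxz] := compact_EVT_max D0 (compact_difference_body cK)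
  (continuous_subspaceT (@continuous_fdot_self R n 1)).
have ubz : ubound [set enorm (x - y) | x in K & y in K] (enorm z).
  move=> _ [x Kx [y Ky <-]]; rewrite enorm_le ?enorm_ge0// enorm_sqr.
  by apply: maxz; apply/mem_set; exists x => //; exists y.
exists z => //; apply/eqP; rewrite eq_le; apply/andP; split.
  apply: ub_le_sup; first by exists (enorm z).
  by have [x Kx [y Ky <-]] := Dz; exists x => //; exists y.
apply: ge_sup => //; have [x Kx] := K0.
by exists (enorm (x - x)), x => //; exists x.
Qed.

Lemma diam_ub z : difference_body K z -> enorm z <= diam K.
Proof.
move=> [x Kx [y Ky <-]]; apply: ub_le_sup; last by exists x => //; exists y.
have [M _ hM] := compact_upper_bound (compact_difference_body cK) (@continuous_fdot_self R n 1).
exists (Num.sqrt M) => _ [a Ka [b Kb <-]]; rewrite enormE ler_wsqrtr//.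
by apply: hM; exists a => //; exists b.
Qed.

Lemma diam_le r : (forall z, difference_body K z -> enorm z <= r) -> diam K <= r.
Proof. by have [z Dz <-] := diam_attained; exact. Qed.

Lemma diam_ge0 : 0 <= diam K.
Proof. by have [z _ <-] := diam_attained; exact: enorm_ge0. Qed.

End Diameter.

Lemma difference_body_neq0 (R : realType) (n : nat) (K : set 'cV[R]_n) :
  K !=set0 -> difference_body K !=set0.
Proof. by move=> [x Kx]; exists (x - x), x => //; exists x. Qed.

(** By symmetry of K - K, a longest vector z in it is at distance 2 |z| from the point - z of K -
    K. *)
Lemma diam_difference_body (R : realType) (n : nat) (K : set 'cV[R]_n) :
  compact K -> K !=set0 -> diam (difference_body K) = 2 * diam K.
Proof.
move=> cK K0; have cD := compact_difference_body cK; have D0 := difference_body_neq0 K0.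
apply/eqP; rewrite eq_le; apply/andP; split.
  by apply: diam_le => // _ [x Dx [y Dy <-]]; apply: enorm_sub_le; exact: diam_ub.
have [z Dz <-] := diam_attained cK K0.
rewrite -[2]gtr0_norm// -enormZ scaler_nat mulr2n -{2}[z]opprK.
apply: diam_ub => //; exists z => //; exists (- z) => //; exact: difference_bodyN.
Qed.

Lemma diam_gt0 (R : realType) (n : nat) (K : set 'cV[R]_n) :
  (0 < n)%N -> compact K -> K° !=set0 -> 0 < diam K.
Proof.
move=> n0 cK iK; have [z] := interior_difference_body iK.
have K0 : K !=set0 by have [c /nbhs_singleton] := iK; exists c.
move=> /nbhs_ballP[e /= e0 eD].
pose w := z + const_mx (e / 2) : 'cV[R]_n.
have Dz : difference_body K z by apply: eD; exact: ballxx.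
have Dw : difference_body K w.
  apply: eD; split => // i j; rewrite -ball_normE/= !mxE opprD addrA subrr sub0r normrN.
  by rewrite gtr0_norm ?divr_gt0// ltr_pdivrMr// ltr_pMr// ltr1n.
have wz : w != z.
  apply/eqP => /matrixP/(_ (Ordinal n0) 0); rewrite /w !mxE => /eqP.
  by rewrite -[X in _ == X]addr0 (inj_eq (addrI _)) gt_eqF ?divr_gt0.
rewrite ltNge; apply/negP => d0.
have h x : difference_body K x -> x = 0.
  move=> Dx; apply/eqP; apply/negPn/negP => /enorm_gt0; rewrite ltNge => /negP; apply.
  exact: le_trans (diam_ub cK Dx) d0.
by move: wz; rewrite (h _ Dw) (h _ Dz) eqxx.
Qed.

Lemma linear_image_neq0 (R : realType) (n : nat) (A : 'M[R]_n) (K : set 'cV[R]_n) :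
  K !=set0 -> linear_image A K !=set0.
Proof. by move=> [x Kx]; exists (A *m x), x. Qed.

Lemma diam_linear_image_gt0 (R : realType) (n : nat) (A : 'M[R]_n) (K : set 'cV[R]_n) :
  A \in unitmx -> compact K -> K !=set0 -> 0 < diam K -> 0 < diam (linear_image A K).
Proof.
move=> uA cK K0 D0; have [z Dz zE] := diam_attained cK K0.
have z0 : A *m z != 0.
  apply/eqP => Az; move: D0; rewrite -zE -[z](mulKmx uA) Az mulmx0.
  by rewrite enormE fdot_cV big1 ?sqrtr0 ?ltxx// => i _; rewrite mxE expr0n.
apply: lt_le_trans (enorm_gt0 z0) _; apply: diam_ub.
  exact: compact_linear_image.
by rewrite difference_body_linear_image; exists z.
Qed.

(** The volume of K is positive and finite, so it cancels; what is left compares determinants with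
    diameters. *)
Lemma behrend_positionP (R : realType) (n : nat) (K : set 'cV[R]_n) :
  (0 < n)%N -> compact K -> K° !=set0 ->
  behrend_position K <->
  (forall A, A \in unitmx -> `|\det A| * diam K ^+ n <= diam (linear_image A K) ^+ n).
Proof.
move=> n0 cK iK; have K0 : K !=set0 by have [c /nbhs_singleton] := iK; exists c.
have clK : closed K by exact: compact_closed.
have D0 := diam_gt0 n0 cK iK.
have vol_fin : vol K \is a fin_num by rewrite ge0_fin_numE ?vol_ge0// vol_compact_fin.
have v0 : 0 < fine (vol K) by rewrite fine_gt0// vol_interior_gt0//= vol_compact_fin.
have le_idq A : A \in unitmx ->
    (idq (linear_image A K) <= idq K)%E =
    (`|\det A| * diam K ^+ n <= diam (linear_image A K) ^+ n).
  move=> uA; rewrite /idq vol_linear_image// -(fineK vol_fin) -!EFinM lee_fin.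
  have DA0 := diam_linear_image_gt0 uA cK K0 D0.
  rewrite (mulrC `|_|) -mulrA ler_pM2l// ler_pdivrMr ?exprn_gt0//.
  by rewrite mulrC ler_pdivlMr ?exprn_gt0.
split => [[_ ub] A uA|h]; first by rewrite -le_idq//; apply: ub; exists A.
split; last by move=> _ [A uA <-]; rewrite le_idq// h.
exists 1%:M; first exact: unitmx1.
by congr idq; apply/seteqP; split => x /=; [move=> [y Ky <-]|exists x => //]; rewrite mul1mx.
Qed.

(** * Loewner position and the equivalences *)

(** By convexity a segment lies in K as soon as its endpoints do, so the condition can be read off
    from K - K. *)
Lemma diametrical_directionsP (R : realType) (n : nat) (K : set 'cV[R]_n) (u : 'cV[R]_n) :
  convex_set K ->
  diametrical_directions K u <-> enorm u = 1 /\ difference_body K (diam K *: u).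
Proof.
move=> /convex_setP cK; split => -[u1].
  move=> [x Kx xuK]; split => //; exists (x + diam K *: u); last first.
    by exists x => //; rewrite addrC addKr.
  by apply: xuK; exists 1; rewrite ?scale1r//= in_itv/= lexx ler01.
move=> [a Ka [b Kb abu]]; split => //; exists b => // _ [t /= + <-].
rewrite in_itv/= => t01.
have -> : b + diam K *: (t *: u) = t *: a + (1 - t) *: b.
  rewrite scalerA mulrC -scalerA -abu scalerBl scale1r scalerBr.
  by rewrite addrCA.
exact: cK.
Qed.

Lemma det_le_of_decomposition (R : realType) (n m : nat) (l : 'I_m -> R)
    (u : 'I_m -> 'cV[R]_n) (A : 'M[R]_n) (r : R) :
  (forall i, 0 <= l i) -> (forall i, enorm (u i) = 1) ->
  1%:M = \sum_i l i *: (u i *m (u i)^T) ->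
  0 <= r -> (forall i, enorm (A *m u i) <= r) -> `|\det A| <= r ^+ n.
Proof.
move=> l0 u1 dec r0 Ar.
have suml : \sum_i l i = n%:R.
  rewrite -(mxtrace1 R n) dec raddf_sum/=; apply: eq_bigr => i _.
  by rewrite mxtraceZ tr_outer ((enorm_eq1 _).1 (u1 i)) mulr1.
have trA : \tr (A^T *m A) <= n%:R * r ^+ 2.
  rewrite -[A^T *m A]mulmx1 dec mulmx_sumr raddf_sum/= -suml mulr_suml.
  apply: ler_sum => i _; rewrite -scalemxAr mxtraceZ ler_wpM2l//.
  (* By cyclicity of the trace, tr (A^T A u u^T) = |A u|^2. *)
  rewrite mulmxA mxtrace_mulC !mulmxA -trmx_mul -mulmxA.
  by have := Ar i; rewrite enorm_le.
rewrite -(@ler_pXn2r _ 2)// ?nnegrE ?exprn_ge0// real_normK ?num_real//.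
apply: le_trans (det_sqr_le A) _; rewrite -exprM mulnC exprM.
case: n => [|n] in u A u1 dec Ar suml trA *; first by rewrite !expr0.
rewrite lerXn2r// ?nnegrE ?exprn_ge0//; last by rewrite ler_pdivrMr// mulrC.
by rewrite divr_ge0// fdot_ge0.
Qed.

(** The ellipsoid A^-1 B, with B the unit ball, contains C, and its volume is vol B / |det A|. *)
Lemma loewner_position_det_le (R : realType) (n : nat) (C : set 'cV[R]_n) (A : 'M[R]_n) :
  loewner_position C -> A \in unitmx -> (forall x, C x -> enorm (A *m x) <= 1) ->
  `|\det A| <= 1.
Proof.
move=> [_ minC] uA CA.
have uA' : invmx A \in unitmx by rewrite unitmx_inv.
have := minC [set 0 + invmx A *m x | x in @eball R n].
rewrite vol_affine_image//; last exact: closed_eball.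
have fv : vol (@eball R n) \is a fin_num by rewrite ge0_fin_numE ?vol_ge0// vol_eball_fin.
have v0 : 0 < fine (vol (@eball R n)) by rewrite fine_gt0// vol_eball_gt0 vol_eball_fin.
rewrite -(fineK fv) -EFinM lee_fin det_inv normfV -{1}[fine _]mul1r ler_pM2r//.
rewrite invf_ge1 ?normr_gt0 -?unitfE -?unitmxE//; apply.
  by exists 0, (invmx A).
by move=> x Cx; exists (A *m x); [exact: CA|rewrite add0r mulKmx].
Qed.

(* The symmetry of U allows one to recenter the ellipsoid: if c + A y and
   c + A z are u and - u, then A^-1 u = (y - z) / 2. *)
Lemma loewner_position_intro (R : realType) (n : nat) (U C : set 'cV[R]_n) :
  (forall u, U u -> U (- u)) -> U `<=` C -> C `<=` @eball R n ->
  (forall A, A \in unitmx -> (forall u, U u -> enorm (A *m u) <= 1) -> `|\det A| <= 1) ->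
  loewner_position C.
Proof.
move=> UN UC CB UA; split => // _ [c [A [uA ->]]] CE.
rewrite vol_affine_image//; last exact: closed_eball.
have fv : vol (@eball R n) \is a fin_num by rewrite ge0_fin_numE ?vol_ge0// vol_eball_fin.
have v0 : 0 < fine (vol (@eball R n)) by rewrite fine_gt0// vol_eball_gt0 vol_eball_fin.
rewrite -(fineK fv) -EFinM lee_fin -{1}[fine _]mul1r ler_pM2r//.
rewrite -[leRHS]invrK invf_ge1 ?invr_gt0 ?normr_gt0 -?unitfE -?unitmxE//.
rewrite -normfV -det_inv; apply: UA; first by rewrite unitmx_inv.
move=> u Uu; have [y By uE] := CE _ (UC _ Uu); have [z Bz nuE] := CE _ (UC _ (UN _ Uu)).
have -> : invmx A *m u = 2^-1 *: (y - z).
  have -> : u = A *m (2^-1 *: (y - z)).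
    rewrite -scalemxAr mulmxBr.
    have -> : A *m y - A *m z = u - - u.
      by rewrite -{1}uE -nuE opprD addrA [c + _]addrC addrK.
    by rewrite opprK -mulr2n -(scaler_nat _ u) scalerA mulVf ?scale1r.
  by rewrite mulKmx.
rewrite enormZ gtr0_norm ?invr_gt0// mulrC ler_pdivrMr// mul1r -[leRHS]mulr1.
exact: enorm_sub_le.
Qed.

Section BehrendPosition.
Variables (R : realType) (n : nat) (K : set 'cV[R]_n).
Hypotheses (n0 : (0 < n)%N) (hK : convex_body K).
Let D := diam K.
Let DB := difference_body K.
Let DK := diametrical_directions K.

Let cK : compact K. Proof. by have [] := hK. Qed.
Let convK : convex_set K. Proof. by have [] := hK. Qed.
Let iK : K° !=set0. Proof. by have [] := hK. Qed.
Let K0 : K !=set0. Proof. by have [c /nbhs_singleton] := iK; exists c. Qed.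
Let D0 : 0 < D. Proof. exact: diam_gt0. Qed.

Let DKP u : DK u <-> enorm u = 1 /\ DB (D *: u).
Proof. exact: diametrical_directionsP. Qed.

Let DKN u : DK u -> DK (- u).
Proof.
by move=> /DKP[u1 Du]; apply/DKP; rewrite enormN scalerN; split => //; exact: difference_bodyN.
Qed.

Let DK_unit u : DK u -> fdot u u = 1.
Proof. by move=> /DKP[/enorm_eq1]. Qed.

Let DK_sub_dilate : DK `<=` dilate D^-1 DB.
Proof.
by move=> u /DKP[_ Du]; exists (D *: u) => //; rewrite scalerA mulVf ?scale1r ?gt_eqF.
Qed.

Let dilate_sub_eball : dilate D^-1 DB `<=` @eball R n.
Proof.
move=> _ [z Dz <-]; rewrite /eball/= enormZ gtr0_norm ?invr_gt0// mulrC ler_pdivrMr// mul1r.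
exact: diam_ub.
Qed.

(** With the two preceding inclusions, this identifies [DK] as the set of contact points of (K - K)
    / D with the unit sphere. *)
Let DK_of_dilate x : dilate D^-1 DB x -> fdot x x = 1 -> DK x.
Proof.
move=> [z Dz <-] /enorm_eq1 x1; apply/DKP; split => //.
by rewrite scalerA divff ?scale1r ?gt_eqF.
Qed.

Let DK_neq0 : DK !=set0.
Proof.
have [z Dz zD] := diam_attained cK K0; exists (D^-1 *: z); apply: DK_of_dilate; first by exists z.
by apply/enorm_eq1; rewrite enormZ zD gtr0_norm ?invr_gt0// mulVf// gt_eqF.
Qed.

Let compact_DK : compact DK.
Proof.
have -> : DK = [set x | dilate D^-1 DB x /\ 1 <= fdot x x].
  apply/seteqP; split => x /=.
    by move=> Dx; split; [exact: DK_sub_dilate|rewrite DK_unit].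
  move=> [Dx x1]; apply: DK_of_dilate => //; apply/eqP; rewrite eq_le x1 andbT.
  by have := dilate_sub_eball Dx; rewrite /eball/= enorm_le1.
apply: compact_closed_cond; last exact: continuous_fdot_self.
by apply: compact_dilate; exact: compact_difference_body.
Qed.

Lemma decomposition_of_det_le :
  (forall A, A \in unitmx -> (forall z, DB z -> enorm (A *m z) <= D) -> `|\det A| <= 1) ->
  exists (m : nat) (lambda : 'I_m -> R) (u : 'I_m -> 'cV[R]_n),
    [/\ (n <= m <= 'C(n.+1, 2))%N, forall i, 0 <= lambda i, forall i, DK (u i) &
        1%:M = \sum_(i < m) lambda i *: (u i *m (u i)^T)].
Proof.
move=> hA; have [[l [u [l0 Du dec]]]|[H [d [d0 trH Hd]]]] :=
  john_alternative DK_unit n0 compact_DK DK_neq0.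
  (* Zero coefficients are allowed, so m can always be the upper bound; n <= m then follows from
     C(n+1, 2) = C(n, 2) + n. *)
  exists 'C(n.+1, 2), l, u; split => //; rewrite leqnn andbT.
  by move: n0; rewrite binS bin1 => _; exact: leq_addl.
have cC : compact (dilate D^-1 DB).
  by apply: compact_dilate; exact: compact_difference_body.
have [||t0 t00 ht0] := ball_perturbation (H := H) cC _ d0.
- by move=> x /dilate_sub_eball; rewrite /eball/= enorm_le1.
- by move=> x Cx x1; apply: Hd; exact: DK_of_dilate.
have [B hB] := det_one_add_ge H n0.
(* The bound t0 keeps (K - K) / D inside the unit ball; the last bound gives t B < tr H, so the
   linear term of the determinant dominates. *)
pose t := Num.min 1 (Num.min t0 (\tr H / (2 * (`|B| + 1)))).
have B1 : 0 < 2 * (`|B| + 1) by rewrite mulr_gt0// ltr_wpDl.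
have tp : 0 < t by rewrite !lt_min ltr01 t00 divr_gt0.
have : t <= t by []; rewrite {2}/t !le_min => /and3P[t1 tt0 tB].
have det1 : 1 < \det (1%:M + t *: H).
  apply: lt_le_trans (hB t _); last by rewrite tp.
  rewrite -addrA ltrDl expr2 -mulrA -mulrBr mulr_gt0// subr_gt0.
  apply: (@le_lt_trans _ _ (t * `|B|)); first by rewrite ler_pM2l// ler_norm.
  move: tB; rewrite ler_pdivlMr// => tB.
  have := normr_ge0 B; nra.
have uA : 1%:M + t *: H \in unitmx by rewrite unitmxE unitfE gt_eqF// (lt_trans ltr01).
have : `|\det (1%:M + t *: H)| <= 1.
  apply: hA => // z Dz.
  have -> : z = D *: (D^-1 *: z) by rewrite scalerA divff ?scale1r ?gt_eqF.
  rewrite -scalemxAr enormZ gtr0_norm// -[leRHS]mulr1 ler_pM2l// enorm_le1.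
  by apply: ht0; [rewrite tp|exists z].
by rewrite leNgt (lt_le_trans det1)// ler_norm.
Qed.

Lemma det_le_of_behrend : behrend_position K ->
  forall A, A \in unitmx -> (forall z, DB z -> enorm (A *m z) <= D) -> `|\det A| <= 1.
Proof.
move=> /(behrend_positionP n0 cK iK) hB A uA AD.
rewrite -(ler_pM2r (exprn_gt0 n D0)) mul1r (le_trans (hB A uA))//.
have cAK := compact_linear_image (A := A) cK.
have AK0 := linear_image_neq0 A K0.
rewrite ler_pXn2r ?nnegrE ?diam_ge0//; apply: diam_le => // z.
by rewrite difference_body_linear_image => -[y Dy <-]; exact: AD.
Qed.

Lemma behrend_position_difference_body :
  behrend_position (difference_body K) <-> behrend_position K.
Proof.
have cDB := compact_difference_body cK.
rewrite (behrend_positionP n0 cK iK).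
rewrite (behrend_positionP n0 cDB (interior_difference_body iK)).
have E A : (`|\det A| * diam (difference_body K) ^+ n <=
    diam (linear_image A (difference_body K)) ^+ n) =
    (`|\det A| * diam K ^+ n <= diam (linear_image A K) ^+ n).
  rewrite -difference_body_linear_image !diam_difference_body//; last 2 first.
  - exact: compact_linear_image.
  - exact: linear_image_neq0.
  by rewrite !exprMn mulrCA ler_pM2l// exprn_gt0.
by split => h A uA; have := h A uA; rewrite E.
Qed.

Section Decomposition.
Variables (m : nat) (lambda : 'I_m -> R) (u : 'I_m -> 'cV[R]_n).
Hypotheses (lambda0 : forall i, 0 <= lambda i) (Du : forall i, DK (u i)).
Hypothesis dec : 1%:M = \sum_(i < m) lambda i *: (u i *m (u i)^T).

Let det_le (A : 'M[R]_n) (r : R) :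
  0 <= r -> (forall i, enorm (A *m u i) <= r) -> `|\det A| <= r ^+ n.
Proof. by apply: (det_le_of_decomposition lambda0 _ dec) => i; have /DKP[] := Du i. Qed.

Lemma behrend_of_decomposition : behrend_position K.
Proof.
apply/(behrend_positionP n0 cK iK) => A uA.
have cAK := compact_linear_image (A := A) cK.
have AK0 := linear_image_neq0 A K0.
(* The radius is r = diam (A K) / D: since D u_i lies in K - K, the vector D A u_i has norm at most
   diam (A K). *)
rewrite -ler_pdivlMr ?exprn_gt0// -expr_div_n; apply: det_le.
  by rewrite divr_ge0 ?diam_ge0// ltW.
move=> i; have /DKP[_ Dui] := Du i.
rewrite ler_pdivlMr// mulrC -[X in X * _]gtr0_norm// -enormZ scalemxAr.
by apply: diam_ub => //; rewrite difference_body_linear_image; exists (D *: u i).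
Qed.

(** Leaving C free between [DK] and the ball covers (iii) and (iv) at once. *)
Lemma loewner_of_decomposition (C : set 'cV[R]_n) :
  DK `<=` C -> C `<=` @eball R n -> loewner_position C.
Proof.
move=> DC CB; apply: (loewner_position_intro DKN DC CB) => A uA hA.
by rewrite -(expr1n R n); apply: det_le => // i; exact: hA.
Qed.

End Decomposition.

Lemma behrend_tfae :
  [<-> behrend_position K;
       behrend_position (difference_body K);
       loewner_position (dilate (diam K)^-1 (difference_body K));
       loewner_position (conv_hull (diametrical_directions K));
       exists (m : nat) (lambda : 'I_m -> R) (u : 'I_m -> 'cV[R]_n),
         [/\ (n <= m <= 'C(n.+1, 2))%N,
             forall i, 0 <= lambda i,
             forall i, diametrical_directions K (u i) &
             1%:M = \sum_(i < m) lambda i *: (u i *m (u i)^T)]].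
Proof.
have DK_sub_hull : DK `<=` conv_hull DK by apply: sub_gen_smallest.
have hull_sub (C : set 'cV[R]_n) : convex_set C -> DK `<=` C -> conv_hull DK `<=` C.
  by move=> cC DC; exact: smallest_sub.
have hull_eball : conv_hull DK `<=` @eball R n.
  apply: hull_sub; first exact: convex_eball.
  by move=> u /DK_sub_dilate/dilate_sub_eball.
tfae.
- by move=> /behrend_position_difference_body.
(* This arrow and the next one pass through (Q) and the decomposition. *)
- move=> /behrend_position_difference_body/det_le_of_behrend.
  move=> /decomposition_of_det_le[m [l [u [_ l0 Du dec]]]].
  exact: (loewner_of_decomposition l0 Du dec).
- move=> hL.
  have /decomposition_of_det_le[m [l [u [_ l0 Du dec]]]] : forall A, A \in unitmx ->
      (forall z, DB z -> enorm (A *m z) <= D) -> `|\det A| <= 1.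
    move=> A uA hA; apply: loewner_position_det_le hL uA _ => _ [z Dz <-].
    by rewrite -scalemxAr enormZ gtr0_norm ?invr_gt0// mulrC ler_pdivrMr// mul1r hA.
  exact: (loewner_of_decomposition l0 Du dec).
- move=> hL; apply: decomposition_of_det_le => A uA hA.
  apply: loewner_position_det_le hL uA _.
  (* The points that A sends into the unit ball form a convex set, so only diametrical directions
     need to be checked. *)
  apply: (hull_sub [set x | @eball R n (A *m x)]).
    exact: convex_preimage_linear (@convex_eball R n).
  move=> u /DKP[_ Du]; rewrite /eball/= -(ler_pM2l D0) mulr1.
  by rewrite -[X in X * _]gtr0_norm// -enormZ scalemxAr hA.
- by move=> [m [l [u [_ l0 Du dec]]]]; exact: (behrend_of_decomposition l0 Du dec).
Qed.

End BehrendPosition.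

(** * Dimension zero *)

Lemma nonempty_dim0 (R : realType) (C : set 'cV[R]_0) : C !=set0 -> C = setT.
Proof. by move=> [x Cx]; apply/seteqP; split => // y _; rewrite (flatmx0 y) -(flatmx0 x). Qed.

Lemma behrend_position_dim0 (R : realType) (K : set 'cV[R]_0) :
  K !=set0 -> behrend_position K.
Proof.
move=> K0; have AK A : linear_image A K = K.
  by rewrite (nonempty_dim0 K0); apply: nonempty_dim0; exists (A *m 0), 0.
split; first by exists 1%:M; [exact: unitmx1|rewrite AK].
by move=> _ [A _ <-]; rewrite AK.
Qed.

Lemma loewner_position_dim0 (R : realType) (C : set 'cV[R]_0) : loewner_position C.
Proof.
have B0 : @eball R 0 = setT.
  by apply: nonempty_dim0; exists 0; rewrite /eball/= /enorm big_ord0 sqrtr0.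
split; first by rewrite B0.
move=> _ [c [A [_ ->]]] _; rewrite B0.
by rewrite [X in (_ <= vol X)%E]nonempty_dim0//; exists (c + A *m 0), 0.
Qed.

Theorem theorem2p3 (R : realType) (n : nat) (K : set 'cV[R]_n)
    (hK : convex_body K) :
  [<-> behrend_position K;
       behrend_position (difference_body K);
       loewner_position (dilate (diam K)^-1 (difference_body K));
       loewner_position (conv_hull (diametrical_directions K));
       exists (m : nat) (lambda : 'I_m -> R) (u : 'I_m -> 'cV[R]_n),
         [/\ (n <= m <= 'C(n.+1, 2))%N,
             forall i, 0 <= lambda i,
             forall i, diametrical_directions K (u i) &
             1%:M = \sum_(i < m) lambda i *: (u i *m (u i)^T)]].
Proof.
case: n K hK => [|n] K hK; last exact: behrend_tfae.
have K0 : K !=set0 by have [_ _ [c /nbhs_singleton]] := hK; exists c.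
tfae => _.
- by apply: behrend_position_dim0; exact: difference_body_neq0.
- exact: loewner_position_dim0.
- exact: loewner_position_dim0.
(* Here C(1, 2) = 0 forces m = 0, and the empty sum is the identity of size 0. *)
- exists 0, (fun=> 0), (fun=> 0); split => //; first by case.
  by rewrite big_ord0 [LHS]flatmx0.
- exact: behrend_position_dim0.
Qed.
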